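(* Suppose that $E(Y^2)<\infty$, $E(\|X\|^2)<\infty$, $V(Y)>0$, $V(X)$ is non-singular, and $E(Y|X)=\alpha_0+X'\beta_0$ for some $(\alpha_0,\beta_0)\in\mathbb{R}\times\mathbb{R}^p$. Let $k\in\{1,\dots,p\}$. Then the identified set $\mathcal{B}_k$ of the $k$-th component $\beta_{0,k}$ of $\beta_0$ satisfies $$\mathcal{B}_k=[-\sigma(-e_k,F_{Y_0},F_{X_0}),\ \sigma(e_k,F_{Y_0},F_{X_0})].$$ Moreover, $$\sigma(e_k,F_{Y_0},F_{X_0})=\frac{1}{\inf_{q\in\mathbb{R}^p:\,q_k=1}1/S(F_{Y_0},F_{X_0'q})},$$ and the same holds for $\sigma(-e_k,F_{Y_0},F_{X_0})$ after replacing $q_k=1$ by $q_k=-1$.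
   Context: $Y$ is a real random variable and $X$ a random vector in $\mathbb{R}^p$. $V(\cdot)$ denotes the variance (matrix), $F_A$ the cdf of $A$, $\overset{d}{=}$ equality in distribution, and $e_k$ the $k$-th element of the canonical basis of $\mathbb{R}^p$. For any integrable $A$, $A_0:=A-E(A)$. For a cdf $F$ on $\mathbb{R}$, $F^{-1}(t)=\inf\{x:F(x)\ge t\}$. The conventions $1/0=\infty$ and $1/\infty=0$ are used. For cdfs $F,G$ on $\mathbb{R}$ with expectation $0$ and $\alpha\in(0,1)$, $R(\alpha,F,G)=\int_\alpha^1F^{-1}(t)dt\big/\int_\alpha^1G^{-1}(t)dt$ and $S(F,G)=\inf_{\alpha\in(0,1)}R(\alpha,F,G)$. Only the marginal distributions of $Y$ and of $X$ are known; the identified set of $\beta_0$ is $$\mathcal{B}=\left\{\beta\in\mathbb{R}^p:\ \exists\text{ random variables }(\widetilde X,\widetilde Y):\ E(\widetilde Y_0|\widetilde X_0)=\widetilde X_0'\beta,\ \widetilde X\overset{d}{=}X,\ \widetilde Y\overset{d}{=}Y\right\},$$ the identified set of $\beta_{0,k}$ is $\mathcal{B}_k=\{e_k'\beta:\beta\in\mathcal{B}\}$, and $\sigma(q,F_{Y_0},F_{X_0})=\sup_{b\in\mathcal{B}}q'b$ is the support function of $\mathcal{B}$. *)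

(* Defs.v *)
From HB Require Import structures.
From mathcomp Require Import all_boot all_order all_algebra.
From mathcomp Require Import all_classical all_reals all_analysis.
From mathcomp Require Import measurable_realfun.

Set Implicit Arguments.
Unset Strict Implicit.
Unset Printing Implicit Defensive.

Import Order.TTheory GRing.Theory Num.Theory.
Import numFieldNormedType.Exports.

Local Open Scope classical_set_scope.
Local Open Scope ring_scope.

(* Random vectors of R^p take values in [p.-tuple R], which carries the product
   (Borel) sigma-algebra; deterministic vectors of R^p are rows ['rV[R]_p]. *)

Definition row_of_tuple (R : realType) (p : nat) (x : p.-tuple R) : 'rV[R]_p :=
  \row_i tnth x i.

Definition dotp (R : realType) (p : nat) (u v : 'rV[R]_p) : R :=
  \sum_(i < p) u 0 i * v 0 i.

Section random_variables.
Context d (T : measurableType d) (R : realType) (P : probability T R).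

Definition component p (X : T -> p.-tuple R) (i : 'I_p) : T -> R :=
  fun t => tnth (X t) i.

Definition variance_matrix p (X : T -> p.-tuple R) : 'M[R]_p :=
  \matrix_(i, j) fine (covariance P (component X i) (component X j)).

Definition centered (Y : T -> R) : T -> R := fun t => Y t - fine 'E_P[Y].

Definition centered_vec p (X : T -> p.-tuple R) : T -> p.-tuple R :=
  fun t => [tuple centered (component X i) t | i < p].

Definition dot_rv p (X : T -> p.-tuple R) (q : 'rV[R]_p) : T -> R :=
  fun t => dotp (row_of_tuple (X t)) q.

(* [is_cond_exp Y X Z]: the random variable [Z] is a version of [E(Y | X)],
   the conditional expectation of [Y] given the sigma-algebra generated
   by [X]. *)
Definition is_cond_exp d' (T' : measurableType d')
    (Y : T -> R) (X : T -> T') (Z : T -> R) : Prop :=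
  [/\ P.-integrable [set: T] (EFin \o Y),
      measurable_fun [set: g_sigma_algebra_preimageType X] Z,
      P.-integrable [set: T] (EFin \o Z) &
      forall A, g_sigma_algebra_preimage X A ->
        (\int[P]_(t in A) (Z t)%:E = \int[P]_(t in A) (Y t)%:E)%E].

Lemma measurable_centered (Y : {mfun T >-> R}) :
  measurable_fun [set: T] (centered Y).
Proof. exact: measurable_funB. Qed.

HB.instance Definition _ (Y : {mfun T >-> R}) :=
  isMeasurableFun.Build _ _ _ _ (centered Y) (measurable_centered Y).

Lemma measurable_component p (X : {mfun T >-> p.-tuple R}) i :
  measurable_fun [set: T] (component X i).
Proof.
apply: (measurableT_comp (f := fun x : p.-tuple R => tnth x i)) => //.
exact: measurable_tnth.
Qed.

HB.instance Definition _ p (X : {mfun T >-> p.-tuple R}) i :=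
  isMeasurableFun.Build _ _ _ _ (component X i) (measurable_component X i).

Lemma measurable_centered_vec p (X : {mfun T >-> p.-tuple R}) :
  measurable_fun [set: T] (centered_vec X).
Proof.
apply/measurable_fun_tnthP => i.
rewrite (_ : _ \o _ = centered (component X i)).
  exact: measurable_centered.
by apply/funext => t /=; rewrite tnth_mktuple.
Qed.

HB.instance Definition _ p (X : {mfun T >-> p.-tuple R}) :=
  isMeasurableFun.Build _ _ _ _ (centered_vec X) (measurable_centered_vec X).

Lemma measurable_dot_rv p (X : {mfun T >-> p.-tuple R}) (q : 'rV[R]_p) :
  measurable_fun [set: T] (dot_rv X q).
Proof.
rewrite /dot_rv /dotp; apply: measurable_sum => i.
apply: measurable_funM => //.
apply: eq_measurable_fun (measurable_component X i) => t _.
by rewrite /component mxE.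
Qed.

HB.instance Definition _ p (X : {mfun T >-> p.-tuple R}) (q : 'rV[R]_p) :=
  isMeasurableFun.Build _ _ _ _ (dot_rv X q) (measurable_dot_rv X q).

End random_variables.

Definition eq_distribution d1 d2 d' (R : realType)
    (T1 : measurableType d1) (T2 : measurableType d2) (T' : measurableType d')
    (P1 : probability T1 R) (P2 : probability T2 R)
    (X1 : {RV P1 >-> T'}) (X2 : {RV P2 >-> T'}) : Prop :=
  forall A : set T', measurable A -> distribution P1 X1 A = distribution P2 X2 A.

(* The witnesses may live on an arbitrary probability space. *)
Definition identified_set d (T : measurableType d) (R : realType)
    (P : probability T R) (p : nat)
    (X : {RV P >-> p.-tuple R}) (Y : {RV P >-> R}) : set 'rV[R]_p :=
  [set b | exists (d' : measure_display) (T' : measurableType d')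
      (P' : probability T' R)
      (X' : {RV P' >-> p.-tuple R}) (Y' : {RV P' >-> R}),
    [/\ is_cond_exp P' (centered P' Y') (centered_vec P' X')
          (dot_rv (centered_vec P' X') b),
        eq_distribution X' X & eq_distribution Y' Y]].

Definition identified_set_component d (T : measurableType d) (R : realType)
    (P : probability T R) (p : nat)
    (X : {RV P >-> p.-tuple R}) (Y : {RV P >-> R}) (k : 'I_p) : set R :=
  [set dotp (delta_mx 0 k) b | b in identified_set X Y].

Definition support_function (R : realType) (p : nat) (A : set 'rV[R]_p)
    (q : 'rV[R]_p) : \bar R :=
  ereal_sup [set (dotp q b)%:E | b in A].

Section superquantile_ratio.
Context {R : realType}.
Local Open Scope ereal_scope.
Implicit Types F G : R -> \bar R.

Definition quantile F (t : R) : \bar R :=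
  ereal_inf [set x%:E | x in [set x | t%:E <= F x]].

(* Extended-real inverse already satisfies [0^-1 = +oo] and [+oo^-1 = 0]. *)
Definition tail_ratio (a : R) F G : \bar R :=
  (\int[lebesgue_measure]_(t in `[a, 1%R]) quantile F t) /
  (\int[lebesgue_measure]_(t in `[a, 1%R]) quantile G t).

Definition inf_tail_ratio F G : \bar R :=
  ereal_inf [set tail_ratio a F G | a in `]0%R, 1%R[].

End superquantile_ratio.

(* Main.v *)
(* A vector b belongs to the identified set iff X_0'b is dominated by Y_0 in the
   convex order, i.e. E(X_0'b - c)^+ <= E(Y_0 - c)^+ for all c. Necessity is
   conditional Jensen. For sufficiency, the variational formula
     int_a^1 F^-1 = min_c ((1 - a) c + E(Z - c)^+)
   turns domination into a comparison of tail integrals of quantile functions,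
   from which a martingale coupling is built explicitly: write X_0'b = x(U) with
   U uniform and x the quantile function of X_0'b (U is a distributional
   transform of X_0'b, on an extension of the space carrying X), and randomize
   between y(U) and y(partner U), y being the quantile function of Y_0.
   Consequently r q is in the identified set iff r <= S(F_{Y_0}, F_{X_0'q}) for
   r >= 0, and this set is convex, closed, and bounded since b |-> E(X_0'b)^+ is
   positive on the unit sphere. *)

From HB Require Import structures.
Require Import Defs.
From mathcomp Require Import all_boot all_order all_algebra.
From mathcomp Require Import all_classical all_reals all_analysis.
From mathcomp Require Import measurable_realfun lra ring.
Import Order.TTheory GRing.Theory Num.Theory.
Import numFieldNormedType.Exports.
Local Open Scope classical_set_scope.
Local Open Scope ring_scope.
Local Open Scope ereal_scope.
Set Implicit Arguments.
Unset Strict Implicit.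
Unset Printing Implicit Defensive.

(** * Quantile transform *)

(** Only the scalar X_0'b enters the convex order, while membership asks for a conditional mean
    given the whole vector X. The coupling is therefore built over the space carrying X: a
    measure-preserving map onto that space, and a variable whose conditional mean given that map is
    X_0'b. Constructing it by hand replaces Strassen's theorem. Two independent uniforms are
    adjoined, one to split the atoms of the law of X_0'b, the other to choose between the two values
    of y.

    Membership has two equivalent forms with different uses. The stop-loss form is convex and
    Lipschitz in b and yields the shape of the set. The tail-integral form is linear along rays, as
    the tail integral of r q is r times that of q; the ratio defining S comes from there. The double
    reciprocal arises because a vector b with b_k = t > 0 is t q with q_k = 1: sigma(e_k) is the
    supremum of S over q_k = 1, and 1/inf 1/S is that supremum, the case S = 0 included. Centering
    makes tail integrals nonnegative and puts 0 in the set; a non-singular V(X) makes the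
    denominators of S positive. *)

Section density.
Import HBNNSimple.
Context d (T : measurableType d) (R : realType).
Variables (mu : {measure set T -> \bar R}) (f : T -> R).
Hypotheses (mf : measurable_fun setT f) (f0 : forall x, (0 <= f x)%R).

Definition density (A : set T) : \bar R := \int[mu]_(x in A) (f x)%:E.

Let density0 : density set0 = 0.
Proof. by rewrite /density integral_set0. Qed.

Let density_ge0 A : 0 <= density A.
Proof. by apply: integral_ge0 => x _; rewrite lee_fin. Qed.

Let density_sigma_additive : semi_sigma_additive density.
Proof.
move=> /= F mF tF mUF; rewrite [X in _ --> X]ge0_integral_bigcup//=.
- apply: is_cvg_ereal_nneg_natsum_cond => n _ _.
  exact: density_ge0.
- by apply/measurable_funTS/measurable_EFinP.
- by move=> x _; rewrite lee_fin.
Qed.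

Definition density_measure_of : {measure set T -> \bar R} :=
  HB.pack density (isMeasure.Build _ _ _ density density0 density_ge0 density_sigma_additive).

(** Simple functions reduce the identity to the hypothesis on [nu], applied to level sets; monotone
    convergence does the rest. As [nu] is any measure with this density, restrictions (indicator
    density) are covered too. *)
Lemma ge0_integral_density (nu : {measure set T -> \bar R}) (g : T -> \bar R) :
  (forall A, measurable A -> nu A = \int[mu]_(x in A) (f x)%:E) ->
  measurable_fun setT g -> (forall x, 0 <= g x) ->
  \int[nu]_x g x = \int[mu]_x ((f x)%:E * g x).
Proof.
move=> nuE mg g0.
pose h := nnsfun_approx measurableT mg.
have -> : \int[nu]_x g x = lim (\int[nu]_x (EFin \o h n) x @[n --> \oo]).
  have gE x : g x = lim ((EFin \o h n) x @[n --> \oo]).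
    by apply/esym/cvg_lim => //; exact: cvg_nnsfun_approx.
  under eq_integral => x _ do rewrite gE.
  apply: monotone_convergence => //.
  - by move=> n; apply/measurable_EFinP.
  - by move=> n x Ex //=; rewrite lee_fin.
  - by move=> x Ex a b ab; rewrite lee_fin; exact/lefP/nd_nnsfun_approx.
have -> : \int[mu]_x ((f x)%:E * g x) =
    lim (\int[mu]_x ((f x)%:E * (EFin \o h n) x) @[n --> \oo]).
  have fg x : (f x)%:E * g x = lim ((f x)%:E * (EFin \o h n) x @[n --> \oo]).
    by apply/esym/cvg_lim => //; apply: cvgeZl => //; exact: cvg_nnsfun_approx.
  under eq_integral => x _ do rewrite fg.
  apply: monotone_convergence => [//| | |].
  - move=> n; apply/emeasurable_funM; exact/measurable_EFinP.
  - by move=> n x Ex /=; rewrite mule_ge0 ?lee_fin.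
  - by move=> x Ex a b ab/=; rewrite lee_wpmul2l ?lee_fin//; exact/lefP/nd_nnsfun_approx.
apply: congr_lim; apply/funext => n.
transitivity (\int[nu]_x
   (\sum_(y \in range (h n)) (y * \1_(h n @^-1` [set y]) x)%:E)).
  by apply: eq_integral => t tE; rewrite /= fimfunE -fsumEFin.
have indich r : measurable_fun setT (fun x => (r * \1_(h n @^-1` [set r]) x)%:E).
  by apply/measurable_EFinP; exact: measurable_funM.
rewrite ge0_integral_fsum//; last by move=> m y Ey; rewrite EFinM; exact: nnfun_muleindic_ge0.
transitivity (\int[mu]_x (\sum_(y \in range (h n))
    ((f x)%:E * (y * \1_(h n @^-1` [set y]) x)%:E))); last first.
  apply: eq_integral => x xE.
  rewrite -ge0_mule_fsumr => [|y]; last by rewrite EFinM; exact: nnfun_muleindic_ge0.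
  by rewrite fsumEFin // -(fimfunE _ x).
rewrite ge0_integral_fsum//; last 2 first.
  - by move=> y; apply: emeasurable_funM => //; exact/measurable_EFinP.
  - by move=> m y Ey; rewrite EFinM; apply: mule_ge0; [rewrite lee_fin|exact: nnfun_muleindic_ge0].
apply: eq_fsbigr => r /[!inE] -[t _ <-].
under eq_integral do rewrite EFinM.
rewrite (integralZl_indic_nnsfun _ _)//.
under [RHS]eq_integral do rewrite EFinM muleCA.
rewrite ge0_integralZl//=; last 3 first.
  by apply: emeasurable_funM; exact/measurable_EFinP.
  by move=> x _; rewrite mule_ge0 ?lee_fin.
  by rewrite lee_fin.
congr (_ * _); rewrite integral_indic// setIT nuE// integral_mkcond.
apply: eq_integral => x _; rewrite patchE indicE; case: ifPn => _;
  by rewrite (mule1, mule0).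
Qed.

End density.

Lemma ge0_integral_mrestr d (T : measurableType d) (R : realType)
    (mu : {measure set T -> \bar R}) (D : set T) (mD : measurable D)
    (g : T -> \bar R) : measurable_fun setT g -> (forall x, 0 <= g x) ->
  \int[mrestr mu mD]_x g x = \int[mu]_(x in D) g x.
Proof.
move=> mg g0; rewrite (@ge0_integral_density _ _ _ mu \1_D)//.
  rewrite [RHS]integral_mkcond; apply: eq_integral => x _.
  by rewrite patchE indicE; case: ifPn => _; rewrite (mul1e, mul0e).
by move=> A mA; rewrite integral_indic//= /mrestr setIC.
Qed.

Lemma lt_natr (R : realType) (x : R) : exists n : nat, (x < n%:R)%R.
Proof.
exists (Num.bound `|x|); exact: le_lt_trans (ler_norm x) (archi_boundP (normr_ge0 x)).
Qed.

(** * Generalized inverse for a finite measure of arbitrary mass *)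

Section quantile_transform.
Context {R : realType}.
Variable m : {measure set R -> \bar R}.
Hypothesis mT : m setT < +oo.
Local Notation leb := (@lebesgue_measure R).

Definition total_mass : R := fine (m setT).
Definition cumul (x : R) : R := fine (m `]-oo, x]%classic).
(** Generalized inverse of [cumul], set to 0 off the open interval: at its endpoints the set is
    unbounded below or possibly empty, and [inf] would be a default value. *)
Definition quant : R -> R :=
  (fun t => inf [set x | t <= cumul x]%R) \_ `]0%R, total_mass[%classic.

Lemma finite_mass A : measurable A -> m A < +oo.
Proof. by move=> mA; apply: le_lt_trans mT; apply: le_measure; rewrite ?inE. Qed.

Lemma total_massE : total_mass%:E = m setT.
Proof. by rewrite fineK// ge0_fin_numE. Qed.

Lemma cumulE x : (cumul x)%:E = m `]-oo, x]%classic.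
Proof. by rewrite fineK// ge0_fin_numE// finite_mass. Qed.

Lemma cumul_nd x y : (x <= y)%R -> (cumul x <= cumul y)%R.
Proof.
move=> xy; rewrite -lee_fin !cumulE le_measure ?inE//.
by apply: subitvPr; rewrite bnd_simp.
Qed.

Lemma measurable_cumul : measurable_fun setT cumul.
Proof. by apply: nondecreasing_measurable => // s t; exact: cumul_nd. Qed.

Lemma cumul_ge0 x : (0 <= cumul x)%R.
Proof. by rewrite -lee_fin cumulE. Qed.

Lemma cumul_le x : (cumul x <= total_mass)%R.
Proof. by rewrite -lee_fin cumulE total_massE le_measure ?inE. Qed.

Lemma cumul_large t : (t < total_mass)%R -> exists x, (t <= cumul x)%R.
Proof.
move=> tM; apply/not_existsP => H.
have : m \o (fun n => `]-oo, n%:R]%classic) @ \oo --> m setT.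
  rewrite -(_ : \bigcup_n `]-oo, n%:R]%classic = [set: R]).
    apply: nondecreasing_cvg_mu => //.
    - exact: bigcup_measurable.
    - move=> i j ij; apply/subsetPset; apply: subitvPr.
      by rewrite bnd_simp ler_nat.
  rewrite -subTset => x _; have [n xn] := lt_natr x.
  by exists n => //=; rewrite in_itv/= ltW.
move=> /cvg_lim mE.
have : lim (m \o (fun n : nat => `]-oo, n%:R]%classic) @ \oo) <= t%:E.
  apply: lime_le.
    by apply: ereal_nondecreasing_is_cvgn => i j ij /=; apply: le_measure; rewrite ?inE//; 
      apply: subitvPr; rewrite bnd_simp ler_nat.
  apply: nearW => n /=; rewrite -cumulE lee_fin ltW// ltNge; apply/negP; exact: H.
by rewrite mE// -total_massE lee_fin leNgt tM.
Qed.

Lemma cumul_small t : (0 < t)%R -> exists x, (cumul x < t)%R.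
Proof.
move=> t0; apply/not_existsP => H.
have : m \o (fun n => `]-oo, (- n%:R)%R]%classic) @ \oo --> m set0.
  rewrite -(_ : \bigcap_n `]-oo, (- n%:R)%R]%classic = set0 :> set R).
    apply: nonincreasing_cvg_mu => //.
    - exact: finite_mass.
    - exact: bigcap_measurable.
    - move=> i j ij; apply/subsetPset; apply: subitvPr.
      by rewrite bnd_simp lerN2 ler_nat.
  rewrite -subset0 => x xn; have [n nx] := lt_natr (- x).
  by have := xn n I; rewrite /= in_itv/=; lra.
move=> /cvg_lim mE.
have : t%:E <= lim (m \o (fun n : nat => `]-oo, (- n%:R)%R]%classic) @ \oo).
  apply: lime_ge.
    by apply: ereal_nonincreasing_is_cvgn => i j ij /=; apply: le_measure; rewrite ?inE//; 
      apply: subitvPr; rewrite bnd_simp lerN2 ler_nat.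
  apply: nearW => n /=; rewrite -cumulE lee_fin leNgt; apply/negP; exact: H.
by rewrite mE// measure0 lee_fin leNgt t0.
Qed.

Lemma cumul_rc t x : (forall n : nat, (t <= cumul (x + n.+1%:R^-1))%R) -> (t <= cumul x)%R.
Proof.
move=> H.
have : m \o (fun n => `]-oo, (x + n.+1%:R^-1)%R]%classic) @ \oo --> m `]-oo, x]%classic.
  rewrite (itvNycEbigcap false x).
  apply: nonincreasing_cvg_mu => //.
  - exact: finite_mass.
  - exact: bigcap_measurable.
  - move=> i j ij; apply/subsetPset; apply: subitvPr.
    by rewrite bnd_simp lerD2l lef_pV2 ?posrE// ler_nat.
move=> /cvg_lim mE; rewrite -lee_fin cumulE -mE//.
apply: lime_ge.
  apply: ereal_nonincreasing_is_cvgn => i j ij /=; apply: le_measure; rewrite ?inE//.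
  by apply: subitvPr; rewrite bnd_simp lerD2l lef_pV2 ?posrE// ler_nat.
by apply: nearW => n /=; rewrite -cumulE lee_fin.
Qed.

Lemma quantE t : (0 < t < total_mass)%R -> quant t = inf [set x | t <= cumul x]%R.
Proof. by move=> t0; rewrite /quant patchE mem_set//= in_itv/=. Qed.

(** Galois connection between [quant] and [cumul]: right continuity ([cumul_rc]) puts the infimum
    itself in the set. Later facts on [quant] go through this equivalence. *)
Lemma quant_le t x : (0 < t < total_mass)%R -> (quant t <= x)%R = (t <= cumul x)%R.
Proof.
move=> tM; have /andP[t0 tM1] := tM; rewrite quantE//.
have [z zt] := cumul_small t0.
have lbz : lbound [set x | t <= cumul x]%R z.
  move=> y /= ty; rewrite leNgt; apply/negP => yz.
  have := cumul_nd (ltW yz); lra.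
apply/idP/idP => [|tx]; last by apply: ge_inf => //; exists z.
move=> qx; apply: cumul_rc => n.
have [y yt] := cumul_large tM1.
have [||w /= tw wx] := @inf_lt _ [set x | t <= cumul x]%R (x + n.+1%:R^-1)%R.
- by exists y.
- by apply: le_lt_trans qx _; rewrite ltrDl.
by apply: le_trans tw _; apply: cumul_nd; exact: ltW.
Qed.

Lemma quant_nd s t : (0 < s)%R -> (s <= t)%R -> (t < total_mass)%R ->
  (quant s <= quant t)%R.
Proof.
move=> s0 st tM; rewrite quant_le; last by rewrite s0 (le_lt_trans st).
by apply: (le_trans st); rewrite -quant_le//; rewrite tM (lt_le_trans s0 st).
Qed.

Lemma measurable_quant : measurable_fun setT quant.
Proof.
rewrite /quant; apply/(measurable_restrictT _ _).1 => //.
apply: (measurability (@RGenOInfty.G R)) => [|/= _ [_] [x] -> <-].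
  exact: RGenOInfty.measurableE.
rewrite (_ : _ `&` _ = `]0%R, total_mass[ `&` `]cumul x, +oo[)//.
  exact: measurableI.
apply/seteqP; split=> t /=; rewrite !in_itv/= !andbT => -[t01];
  by rewrite -(quantE t01) => H; split=> //; move: H; rewrite !ltNge quant_le.
Qed.

(** Both measures agree on the rays []x, +oo[], a generating family closed under intersection: by
    [quant_le] the preimage of such a ray is []cumul x, total_mass[], whose length is the mass of
    the ray. *)
Lemma pushforward_quant A : measurable A -> m A = leb (`]0%R, total_mass[ `&` quant @^-1` A).
Proof.
move=> mA; pose mI : measurable `]0%R, total_mass[%classic := measurable_itv _.
rewrite setIC.
have := @measure_unique _ _ _ (@RGenOInfty.G R) (fun n => `](- n%:R)%R, +oo[%classic) _ _ _ _ m
  (pushforward (mrestr leb mI) quant) _ _ A mA; apply.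
- exact: RGenOInfty.measurableE.
- move=> _ _ [x ->] [y ->]; exists (Num.max x y).
  by apply/seteqP; split => z /=; rewrite !in_itv/= !andbT gt_max => /andP.
- by move=> n; eexists.
- rewrite -subTset => x _; have [n nx] := lt_natr (- x).
  by exists n => //=; rewrite in_itv/= andbT; lra.
- exact: measurable_quant.
- move=> ?; move=> _ [x ->]; 
  change (m `]x, +oo[%classic = leb (quant @^-1` `]x, +oo[ `&` `]0%R, total_mass[)).
  have -> : quant @^-1` `]x, +oo[ `&` `]0%R, total_mass[ = `]cumul x, total_mass[%classic.
    apply/seteqP; split=> t /=; rewrite !in_itv/= ?andbT.
      move=> [xq t01]; have /andP[_ ->] := t01.
      by rewrite andbT ltNge -quant_le// -ltNge.
    move=> /andP[xt tM]; have t01 : (0 < t < total_mass)%R.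
      by rewrite tM (le_lt_trans (cumul_ge0 x)).
    by rewrite ltNge quant_le// -ltNge xt.
  rewrite lebesgue_measure_itv/= lte_fin.
  have -> : `]x, +oo[%classic = setT `\` `]-oo, x]%classic :> set R by rewrite setTD setCitvl.
  rewrite measureD ?setTI//= -total_massE -cumulE.
  rewrite -EFinB; case: ltP => // /(conj (cumul_le x)) /andP; rewrite -eq_le => /eqP ->.
  by rewrite subrr.
- by move=> n; exact: finite_mass.
Qed.

Lemma integral_quant (g : R -> \bar R) : measurable_fun setT g -> (forall x, 0 <= g x) ->
  \int[m]_x g x = \int[leb]_(t in `]0%R, total_mass[) g (quant t).
Proof.
move=> mg g0; pose mI : measurable `]0%R, total_mass[%classic := measurable_itv _.
rewrite -[RHS](@ge0_integral_mrestr _ _ _ leb _ mI (g \o quant))//.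
2:{ exact: (measurableT_comp mg measurable_quant). }
transitivity (\int[pushforward (mrestr leb mI) quant]_x g x).
  apply: eq_measure_integral; first exact: measurable_quant.
  move=> ? A mA _.
  by have := pushforward_quant mA; rewrite setIC => E; exact: E.
apply: (etrans (ge0_integral_pushforward _ _ _ _ _)) => //.
  exact: measurable_quant.
by move=> x; exact: g0.
Qed.

(** By [quant_le], [cumul] stays below [t] strictly left of [quant t], and the open ray is an
    increasing union of closed rays ending there. *)
Lemma mass_lt_quant t : (0 < t < total_mass)%R -> m `]-oo, (quant t)[%classic <= t%:E.
Proof.
move=> t01.
pose B n : set R := `]-oo, (quant t - n.+1%:R^-1)%R]%classic.
have -> : `]-oo, (quant t)[%classic = \bigcup_n B n :> set R.
  apply/seteqP; split => x /=; last first.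
    move=> [n _]; rewrite /B /= !in_itv/= => /le_lt_trans; apply.
    by rewrite ltrBlDr ltrDl invr_gt0.
  rewrite in_itv/= => /ltr_add_invr[n xn]; exists n => //=.
  by rewrite /B /= in_itv/= lerBrDr ltW.
have ndB i j : (i <= j)%N -> B i `<=` B j.
  by move=> ij; apply: subitvPr; rewrite bnd_simp lerD2l lerN2 lef_pV2 ?posrE// ler_nat.
have mB n : measurable (B n) by exact: measurable_itv.
apply: (@le_trans _ _ (lim (m \o B @ \oo))).
  have /cvg_lim -> // : m \o B @ \oo --> m (\bigcup_n B n).
  apply: nondecreasing_cvg_mu => //; first exact: bigcup_measurable.
  by move=> i j ij; apply/subsetPset; exact: ndB.
apply: lime_le.
  apply: ereal_nondecreasing_is_cvgn => i j ij /=; apply: le_measure; rewrite ?inE//.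
  exact: ndB.
apply: nearW => n /=; rewrite -cumulE lee_fin leNgt; apply/negP => /ltW.
by rewrite -quant_le// leNgt ltrBlDr ltrDl invr_gt0 ltr0Sn.
Qed.

(** Without atoms the closed and the open ray at [quant t] have the same mass, which [quant_le] and
    [mass_lt_quant] bound by [t] from either side. *)
Lemma cumul_quant t : (forall x, m [set x] = 0) -> (0 < t < total_mass)%R ->
  cumul (quant t) = t.
Proof.
move=> m0 t01; apply/eqP; rewrite eq_le; apply/andP; split; last by rewrite -quant_le.
rewrite -lee_fin cumulE -(@setUitv1 _ _ -oo%O (quant t) true)//.
rewrite (le_trans (measureU2 _ _ _))// [X in _ + X]m0 adde0.
exact: mass_lt_quant.
Qed.

End quantile_transform.

(** * Quantiles, stop-loss transforms and tail integrals of a random variable *)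

Section random_variable_quantile.
Context d (T : measurableType d) (R : realType) (P : probability T R).
Variable Z : {RV P >-> R}.
Local Notation leb := (@lebesgue_measure R).
Local Notation I01 := (`]0%R, 1%R[%classic : set R).

Definition rv_quant : R -> R := quant (distribution P Z).

Let mT : distribution P Z setT < +oo.
Proof. by rewrite (@probability_setT _ _ _ (distribution P Z)) ltry. Qed.

Let M1 : total_mass (distribution P Z) = 1%R.
Proof. exact: (congr1 fine (@probability_setT _ _ _ (distribution P Z))). Qed.

Lemma measurable_rv_quant : measurable_fun setT rv_quant.
Proof. exact: measurable_quant. Qed.

Lemma rv_quant_le t x : (0 < t < 1)%R -> (rv_quant t <= x)%R = (t%:E <= cdf Z x).
Proof.
by move=> t01; rewrite /rv_quant quant_le ?M1// -lee_fin cumulE.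
Qed.

Lemma rv_quant_nd s t : (0 < s)%R -> (s <= t)%R -> (t < 1)%R ->
  (rv_quant s <= rv_quant t)%R.
Proof. by move=> *; apply: quant_nd; rewrite ?M1. Qed.

Lemma quantile_cdf t : (0 < t < 1)%R -> quantile (cdf Z) t = (rv_quant t)%:E.
Proof.
move=> t01; apply/eqP; rewrite eq_le; apply/andP; split.
  by apply: ereal_inf_lbound; exists (rv_quant t) => //=; rewrite -rv_quant_le.
by apply: le_ereal_inf_tmp => _ [x /= tx <-]; rewrite lee_fin rv_quant_le.
Qed.

Lemma ge0_integral_rv_quant (g : R -> \bar R) :
  measurable_fun setT g -> (forall x, 0 <= g x) ->
  \int[P]_w g (Z w) = \int[leb]_(t in I01) g (rv_quant t).
Proof.
move=> mg g0; rewrite -(@ge0_integral_distribution _ _ _ _ _ P Z g)//.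
by rewrite integral_quant// M1.
Qed.

Lemma integral_rv_quant (g : R -> \bar R) : measurable_fun setT g ->
  \int[P]_w g (Z w) = \int[leb]_(t in I01) g (rv_quant t).
Proof.
move=> mg.
have Ep : \int[P]_w (g^\+ \o Z) w = \int[leb]_(t in I01) (g^\+ \o rv_quant) t.
  by apply: ge0_integral_rv_quant; [exact: measurable_funepos|exact: funepos_ge0].
have En : \int[P]_w (g^\- \o Z) w = \int[leb]_(t in I01) (g^\- \o rv_quant) t.
  by apply: ge0_integral_rv_quant; [exact: measurable_funeneg|exact: funeneg_ge0].
rewrite -[LHS]/(\int[P]_w (g \o Z) w) -[RHS]/(\int[leb]_(t in I01) (g \o rv_quant) t).
by rewrite integralE [RHS]integralE (funepos_comp g Z) (funeneg_comp g Z) (funepos_comp g rv_quant) (funeneg_comp g rv_quant) Ep En.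
Qed.

Hypothesis iZ : P.-integrable setT (EFin \o Z).

Lemma integrable_rv_quant : leb.-integrable I01 (EFin \o rv_quant).
Proof.
apply/integrableP; split.
  by apply/measurable_EFinP; apply: measurable_funTS; exact: measurable_rv_quant.
rewrite -(@ge0_integral_rv_quant (fun x => `|x%:E|))//.
  by have /integrableP[] := iZ.
by apply: measurableT_comp => //; exact/measurable_EFinP.
Qed.

Lemma integrable_rv_quant_itv a : (0 < a < 1)%R ->
  leb.-integrable `]a, 1%R[ (EFin \o rv_quant).
Proof.
move=> /andP[a0 a1]; apply: (integrableS _ _ _ integrable_rv_quant) => //.
by apply: subitvPl; rewrite bnd_simp ltW.
Qed.

Definition stop_loss c : R := (\int[P]_w (Num.max (Z w - c) 0))%R.

Lemma integrable_stop_loss c : P.-integrable setT (fun w => (Num.max (Z w - c) 0)%:E).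
Proof.
have iZc : P.-integrable setT (fun w => (Z w - c)%:E).
  apply: (@integrableB _ _ _ P _ measurableT (EFin \o Z) (cst c%:E)) => //.
  exact: finite_measure_integrable_cst.
apply: (le_integrable _ _ _ iZc) => //.
  apply/measurable_EFinP; apply: measurable_maxr => //.
  exact: measurable_funB.
move=> w _ /=; rewrite lee_fin.
rewrite ger0_norm; last by rewrite le_max lexx orbT.
by rewrite ge_max ler_norm normr_ge0.
Qed.

Lemma stop_lossE c :
  (stop_loss c)%:E = \int[leb]_(t in I01) (Num.max (rv_quant t - c) 0)%:E.
Proof.
rewrite /stop_loss /Rintegral fineK; last first.
  by apply: integrable_fin_num => //; exact: integrable_stop_loss.
rewrite (@ge0_integral_rv_quant (fun x => (Num.max (x - c) 0)%:E))//.
  apply/measurable_EFinP; apply: measurable_maxr => //.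
  exact: measurable_funB.
by move=> x; rewrite lee_fin le_max lexx orbT.
Qed.

(* Tail integral of the quantile function, without the factor [1 / (1 - a)]. *)
Definition superquantile a : R := (\int[leb]_(t in `]a, 1%R[) rv_quant t)%R.

Lemma tail_integral_quantile a : (0 < a < 1)%R ->
  \int[leb]_(t in `[a, 1%R]) quantile (cdf Z) t = (superquantile a)%:E.
Proof.
move=> a01; have /andP[a0 a1] := a01.
rewrite /superquantile /Rintegral fineK; last first.
  by apply: integrable_fin_num => //; exact: integrable_rv_quant_itv.
have E : {in `]a, 1%R[, quantile (cdf Z) =1 EFin \o rv_quant}.
  move=> t; rewrite in_itv/= => /andP[t0 t1]; rewrite quantile_cdf//.
  by rewrite t1 (lt_trans a0).
have mq : measurable_fun `]a, 1%R[ (quantile (cdf Z)).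
  apply: (@eq_measurable_fun _ _ _ _ _ (EFin \o rv_quant)).
    by move=> t /[!inE] /E ->.
  exact: measurable_int (integrable_rv_quant_itv a01).
(* At 1 [quantile] may be [+oo]; both endpoints are null and are dropped before passing to the
   real-valued [rv_quant]. *)
rewrite -integral_itv_bndo_bndc; last first.
  rewrite -(@setU1itv _ _ _ _ false) ?bnd_simp//.
  apply/measurable_funU => //; split => //.
  exact: measurable_fun_set1.
rewrite -integral_itv_obnd_cbnd; last exact: mq.
by apply: eq_integral => t /[!inE] /E ->.
Qed.

Let stop_loss_split a c : (0 < a < 1)%R ->
  (stop_loss c)%:E = \int[leb]_(t in `]0%R, a]) (Num.max (rv_quant t - c) 0)%:E +
     \int[leb]_(t in `]a, 1%R[) (Num.max (rv_quant t - c) 0)%:E.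
Proof.
move=> /andP[a0 a1].
have mm : measurable_fun setT (fun t => (Num.max (rv_quant t - c) 0)%:E).
  apply/measurable_EFinP; apply: measurable_maxr => //.
  apply: measurable_funB => //; exact: measurable_rv_quant.
rewrite stop_lossE -ge0_integral_setU//; last first.
- apply/disj_set2P; rewrite -subset0 => x [] /=; rewrite !in_itv/=; lra.
- by move=> x _; rewrite lee_fin le_max lexx orbT.
- exact: measurable_funTS.
congr (integral _ _ _); apply/seteqP; split => x /=; rewrite !in_itv/=.
  by case: (leP x a) => xa; lra.
by move=> []; lra.
Qed.

Let integrable_cst_itv a c : leb.-integrable `]a, 1%R[ (EFin \o cst c).
Proof.
apply/integrableP; split; first by apply/measurable_EFinP.
rewrite [ltLHS](_ : _ = \int[leb]_(x in `]a, 1%R[) cst `|c|%:E x)//.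
rewrite integral_cst//= lebesgue_measure_itv/=.
by case: ifP => _; rewrite -?EFinB -?EFinM ?mule0 ltry.
Qed.

Let integrable_shift a c : (0 < a < 1)%R ->
  leb.-integrable `]a, 1%R[ (EFin \o (fun t => rv_quant t - c)%R).
Proof.
move=> a01; have iq := integrable_rv_quant_itv a01.
apply: (@integrableB _ _ _ leb _ _ (EFin \o rv_quant) (EFin \o cst c)) => //.
Qed.

Let superquantile_shift a c : (0 < a < 1)%R ->
  superquantile a = ((1 - a) * c + \int[leb]_(t in `]a, 1%R[) (rv_quant t - c))%R.
Proof.
move=> a01; have /andP[a0 a1] := a01; have iq := integrable_rv_quant_itv a01.
have -> : (\int[leb]_(t in `]a, 1%R[) (rv_quant t - c) =
    superquantile a - \int[leb]_(t in `]a, 1%R[) (cst c t))%R by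
  rewrite -RintegralB//; exact: integrable_cst_itv.
have -> : (\int[leb]_(t in `]a, 1%R[) (cst c t) = c * (1 - a))%R.
  have := @Rintegral_cst _ _ _ leb `]a, 1%R[%classic (measurable_itv _) c.
  by rewrite [X in fine X]lebesgue_measure_itv/= lte_fin a1 -EFinB /= => <-.
rewrite /superquantile; lra.
Qed.

(** The positive part is at least [rv_quant t - c] past [a], and at least 0 before [a]. *)
Lemma superquantile_le a c : (0 < a < 1)%R ->
  (superquantile a <= (1 - a) * c + stop_loss c)%R.
Proof.
move=> a01; rewrite (superquantile_shift c a01) lerD2l -lee_fin (stop_loss_split c a01).
rewrite /Rintegral fineK; last by apply: integrable_fin_num => //; exact: integrable_shift.
rewrite -[leLHS]add0e; apply: leeD.
  by apply: integral_ge0 => t _; rewrite lee_fin le_max lexx orbT.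
have mm : measurable_fun setT (fun t => (Num.max (rv_quant t - c) 0)%:E).
  apply/measurable_EFinP; apply: measurable_maxr => //.
  apply: measurable_funB => //; exact: measurable_rv_quant.
apply: le_integral => //=.
- exact: integrable_shift.
- apply: (le_integrable _ _ _ (integrable_shift c a01)) => //.
    exact: measurable_funTS.
  move=> t _ /=; rewrite lee_fin.
  rewrite ger0_norm; last by rewrite le_max lexx orbT.
  by rewrite ge_max ler_norm normr_ge0.
- by move=> t _; rewrite lee_fin le_max lexx.
Qed.

(** At [c = rv_quant a] the bound is attained: by monotonicity the positive part is 0 up to [a] and
    equals [rv_quant t - c] beyond. *)
Lemma superquantileE a : (0 < a < 1)%R ->
  superquantile a = ((1 - a) * rv_quant a + stop_loss (rv_quant a))%R.
Proof.
move=> a01; have /andP[a0 a1] := a01.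
rewrite {1}(superquantile_shift (rv_quant a) a01); congr (_ + _)%R.
apply: EFin_inj; rewrite (stop_loss_split _ a01).
rewrite /Rintegral fineK; last by apply: integrable_fin_num => //; exact: integrable_shift.
rewrite [X in _ = X + _]integral0_eq ?add0e; last first.
  move=> t /=; rewrite in_itv/= => /andP[t0 ta]; congr EFin; apply/max_idPr.
  by rewrite subr_le0 rv_quant_nd.
apply: eq_integral => t /[!inE]/=; rewrite in_itv/= => /andP[ta t1]; congr EFin.
by apply/esym/max_idPl; rewrite subr_ge0 rv_quant_nd// ltW.
Qed.

End random_variable_quantile.

(** * One-dimensional martingale couplings *)

Section excess_measure.
Context {R : realType}.
Local Notation leb := (@lebesgue_measure R).
Local Notation I01 := (`]0%R, 1%R[%classic : set R).
Variables x y : R -> R.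
Hypotheses (mx : measurable_fun setT x) (my : measurable_fun setT y).
Hypotheses (ix : leb.-integrable I01 (EFin \o x)) (iy : leb.-integrable I01 (EFin \o y)).

Definition excess : R -> R := (fun u => Num.max (x u - y u) 0)%R \_ I01.

Lemma excess_ge0 u : (0 <= excess u)%R.
Proof. by rewrite /excess patchE; case: ifPn => // _; rewrite le_max lexx orbT. Qed.

Lemma excess_gt0 u : (0 < excess u)%R -> (0 < u < 1)%R /\ (excess u = x u - y u)%R.
Proof.
rewrite /excess patchE; case: ifPn => [|_]; last by rewrite ltxx.
rewrite inE /= in_itv/= => u01; rewrite lt_max ltxx orbF => xy; split => //.
by apply/max_idPl; exact: ltW.
Qed.

Lemma measurable_excess : measurable_fun setT excess.
Proof.
apply/(measurable_restrictT _ _).1 => //; apply: measurable_funTS.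
by apply: measurable_maxr => //; exact: measurable_funB.
Qed.

Lemma integrable_excess : leb.-integrable I01 (EFin \o excess).
Proof.
have mI : measurable (I01 : set (measurableTypeR R)) by exact: measurable_itv.
have := integrableB mI ix iy; apply: le_integrable => //.
  by apply/measurable_EFinP; apply: measurable_funTS; exact: measurable_excess.
move=> u uI /=; rewrite lee_fin ger0_norm ?excess_ge0//.
rewrite /excess patchE mem_set//.
by rewrite ge_max ler_norm normr_ge0.
Qed.

Let dens := density_measure_of leb measurable_excess excess_ge0.

Let dens_ssa : semi_sigma_additive (dens : set R -> \bar R).
Proof. exact: (@measure_semi_sigma_additive _ _ _ dens). Qed.

(** [dens] is typed over [measurableTypeR R], the carrier of Lebesgue measure; it is repackaged over
    [R], where the quantile transform applies. *)
Definition excess_measure : {measure set R -> \bar R} :=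
  HB.pack (dens : set R -> \bar R)
    (isMeasure.Build _ R R dens (measure0 dens) (measure_ge0 dens) dens_ssa).

Lemma excess_measureE A : excess_measure A = \int[leb]_(u in A) (excess u)%:E.
Proof. by []. Qed.

Lemma excess_measure_itv b c :
  excess_measure [set` Interval b c] = \int[leb]_(u in I01 `&` [set` Interval b c]) (excess u)%:E.
Proof.
rewrite excess_measureE setIC integral_mkcond [RHS]integral_mkcond.
apply: eq_integral => u _; rewrite !patchE in_setI.
case: ifPn => //= _; rewrite /excess patchE.
by case: ifPn.
Qed.

Lemma excess_measureT : excess_measure setT = \int[leb]_(u in I01) (excess u)%:E.
Proof. by rewrite -set_itvE excess_measure_itv set_itvE setIT. Qed.

Lemma excess_measure_lty : excess_measure setT < +oo.
Proof.
rewrite excess_measureT; have /integrableP[_] := integrable_excess.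
by under eq_integral do rewrite /= ger0_norm ?excess_ge0//.
Qed.

Lemma excess_measure1 u : excess_measure [set u] = 0.
Proof. by rewrite excess_measureE integral_set1. Qed.

(** Substitution u = quant v: the measure with density [excess] is the image of Lebesgue measure on
    an interval under its own quantile function. *)
Lemma ge0_integral_excess (g : R -> \bar R) :
  measurable_fun setT g -> (forall u, 0 <= g u) ->
  \int[leb]_u ((excess u)%:E * g u) =
  \int[leb]_(v in `]0%R, total_mass excess_measure[) g (quant excess_measure v).
Proof.
move=> mg g0; rewrite -integral_quant//; last exact: excess_measure_lty.
have id_mfun : measurable_fun [set: measurableTypeR R] (idfun : measurableTypeR R -> R).
  by move=> _ A mA; rewrite setTI.
transitivity (\int[dens]_u g u).
  by apply/esym; apply: (@ge0_integral_density _ _ _ leb excess measurable_excess excess_ge0 dens g).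
transitivity (\int[pushforward dens (idfun : measurableTypeR R -> R)]_u g u).
  by apply/esym; apply: etrans (ge0_integral_pushforward id_mfun _ _ _ _) _.
exact: eq_measure_integral.
Qed.

(** The zero set of [excess] is null for the measure with density [excess], hence its preimage under
    [quant] is Lebesgue-null. *)
Lemma excess_quant_gt0 : {ae leb, forall v, (0 < v < total_mass excess_measure)%R ->
   (0 < excess (quant excess_measure v))%R}.
Proof.
pose N : set R := excess @^-1` `]-oo, 0%R].
have mN : measurable N.
  by rewrite -[X in measurable X]setTI; apply: measurable_excess => //; exact: measurable_itv.
have : \int[leb]_(v in `]0%R, total_mass excess_measure[)
    `|(\1_N (quant excess_measure v))%:E| = 0.
  under eq_integral do rewrite gee0_abs ?lee_fin//.
  rewrite -(@ge0_integral_excess (fun u => (\1_N u)%:E))//.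
    rewrite integral0_eq// => u _; rewrite indicE.
    have [|uN] := boolP (u \in N); last by rewrite mule0.
    rewrite inE /N /= in_itv/= => u0; rewrite (_ : excess u = 0%R) ?mul0e//.
    by apply/eqP; rewrite eq_le u0 excess_ge0.
  by apply/measurable_EFinP.
move/ae_eq_integral_abs => /(_ _ _); case => //.
  apply/measurable_EFinP; apply: measurable_funTS.
  have mq : measurable_fun [set: R] (quant excess_measure) := measurable_quant excess_measure_lty.
  exact: (measurableT_comp (measurable_indic mN) mq).
move=> B [mB B0 sB]; exists B; split => // v /= vN; apply: sB => /= H; apply: vN => v0M.
have := H; rewrite in_itv/= v0M => /(_ isT).
rewrite indicE; have [|+ _] := boolP (_ \in N); first by move=> _ [] /eqP; rewrite oner_eq0.
by rewrite notin_setE /N /= in_itv/= => /negP; rewrite -ltNge.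
Qed.

End excess_measure.

Lemma measurable_inv_norm (R : realType) d (T : measurableType d) (f : T -> R) :
  measurable_fun setT f -> measurable_fun setT (fun t => `|f t|^-1)%R.
Proof.
move=> mf; rewrite (_ : (fun _ => _) = (@powR R ^~ (-1) \o (fun t => `|f t|))%R); last first.
  by apply/funext => t /=; rewrite powR_inv1.
apply: measurableT_comp; first exact: measurable_powR.
exact: measurableT_comp.
Qed.

(** * Exchange between the two regions of the unit interval *)

Section martingale_coupling_on_01.
Context {R : realType}.
Local Notation leb := (@lebesgue_measure R).
Local Notation I01 := (`]0%R, 1%R[%classic : set R).
Variables x y : R -> R.
Hypotheses (mx : measurable_fun setT x) (my : measurable_fun setT y).
Hypotheses (ix : leb.-integrable I01 (EFin \o x)) (iy : leb.-integrable I01 (EFin \o y)).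
Hypotheses (ndx : forall s t, (0 < s)%R -> (s <= t)%R -> (t < 1)%R -> (x s <= x t)%R).
Hypotheses (ndy : forall s t, (0 < s)%R -> (s <= t)%R -> (t < 1)%R -> (y s <= y t)%R).
Hypothesis exy : (\int[leb]_(t in I01) x t = \int[leb]_(t in I01) y t)%R.
Hypothesis sxy : forall u, (0 < u < 1)%R ->
  (\int[leb]_(t in `]u, 1%R[) x t <= \int[leb]_(t in `]u, 1%R[) y t)%R.

Let dp := excess x y.
Let dn := excess y x.
Let mp := excess_measure mx my.
Let mn := excess_measure my mx.
Let M := total_mass mp.
Let a := quant mp.
Let b := quant mn.

Let excess_sub t : (0 < t < 1)%R -> (dp t - dn t = x t - y t)%R.
Proof.
move=> t01; rewrite /dp /dn /excess !patchE mem_set/= ?in_itv//.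
have [h|h] := leP (x t) (y t).
  by rewrite (max_idPr _) ?(max_idPl _); lra.
by rewrite (max_idPl _) ?(max_idPr _); lra.
Qed.

Let excess_disj t : (0 < dp t)%R -> dn t = 0%R.
Proof.
move=> p0; have [t01 dE] := excess_gt0 p0.
have := excess_sub t01; rewrite -dE -/dp; lra.
Qed.

Let integral_excess_sub b0 c0 : [set` Interval b0 c0] `<=` I01 ->
  (fine (mp [set` Interval b0 c0]) - fine (mn [set` Interval b0 c0]) =
   \int[leb]_(t in [set` Interval b0 c0]) x t - \int[leb]_(t in [set` Interval b0 c0]) y t)%R.
Proof.
move=> sI.
have mI : measurable ([set` Interval b0 c0] : set (measurableTypeR R)) by exact: measurable_itv.
have mI1 : measurable (I01 : set (measurableTypeR R)) by exact: measurable_itv.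
have ixs := integrableS mI1 mI sI ix.
have iys := integrableS mI1 mI sI iy.
have ips := integrableS mI1 mI sI (integrable_excess mx my ix iy).
have ins := integrableS mI1 mI sI (integrable_excess my mx iy ix).
rewrite -[LHS]/(\int[leb]_(t in [set` Interval b0 c0]) dp t -
  \int[leb]_(t in [set` Interval b0 c0]) dn t)%R.
rewrite -!RintegralB//; apply: eq_Rintegral => t /[!inE] /sI /=.
by rewrite in_itv/=; exact: excess_sub.
Qed.

Let mpT : mp setT < +oo. Proof. exact: excess_measure_lty. Qed.
Let mnT : mn setT < +oo. Proof. exact: excess_measure_lty. Qed.

(** This is the equality of means, as dp - dn = x - y. *)
Let total_mn : total_mass mn = M.
Proof.
have := @integral_excess_sub (BRight 0%R) (BLeft 1%R) (@subset_refl _ _).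
rewrite exy subrr /M /total_mass !excess_measureT !excess_measureE; lra.
Qed.

(** The convex order enters here: since the total integrals agree, the tail inequality [sxy] past
    [u] reverses into an inequality before [u], so excess of x over y accumulates earlier than
    excess of y over x. *)
Let cumul_le u : (cumul mn u <= cumul mp u)%R.
Proof.
rewrite /cumul !excess_measure_itv.
have [u0|u0] := leP u 0%R.
  rewrite (_ : _ `&` _ = set0); last first.
    by rewrite -subset0 => t [] /=; rewrite !in_itv/=; lra.
  by rewrite !integral_set0.
have [u1|u1] := leP 1%R u.
  rewrite (_ : _ `&` _ = I01); last first.
    by apply/seteqP; split => [t []//|t] /= => tI; split => //; move: tI; rewrite !in_itv/=; lra.
  have := total_mn; rewrite /M /total_mass !excess_measureT => ->; exact: lexx.
rewrite (_ : _ `&` _ = `]0%R, u]%classic); last first.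
  by apply/seteqP; split => [t|t] /=; rewrite !in_itv/= => H; [case: H|split]; lra.
have u01 : (0 < u < 1)%R by rewrite u0.
have := @integral_excess_sub (BRight 0%R) (BRight u).
rewrite !excess_measureE => H; rewrite -subr_ge0 H; last first.
  by move=> t /=; rewrite !in_itv/=; lra.
have mA : measurable (`]0%R, u] : set (measurableTypeR R)) by exact: measurable_itv.
have mB : measurable (`]u, 1%R[ : set (measurableTypeR R)) by exact: measurable_itv.
have UE : I01 = `]0%R, u] `|` `]u, 1%R[.
  apply/seteqP; split => t /=; rewrite !in_itv/=; last by case; lra.
  by case: (leP t u) => tu tI; [left|right]; lra.
have dAB : [disjoint `]0%R, u]%classic & `]u, 1%R[%classic : set R].
  by apply/disj_set2P; rewrite -subset0 => t [] /=; rewrite !in_itv/=; lra.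
have S f : leb.-integrable I01 (EFin \o f) ->
    (\int[leb]_(t in I01) f t = \int[leb]_(t in `]0%R, u]) f t + \int[leb]_(t in `]u, 1%R[) f t)%R.
  by move=> if_; rewrite UE Rintegral_setU// -UE.
have := exy; rewrite (S x ix) (S y iy); have := sxy u01; lra.
Qed.

Let cumul_a v : (0 < v < M)%R -> cumul mp (a v) = v.
Proof. by move=> v0M; apply: cumul_quant => // u; exact: excess_measure1. Qed.

Let cumul_b v : (0 < v < M)%R -> cumul mn (b v) = v.
Proof.
by move=> v0M; apply: cumul_quant => //; rewrite ?total_mn// => u; exact: excess_measure1.
Qed.

(** Mass with y < x is matched with mass further right with x < y. For almost every [v],
    monotonicity of [x] then gives y(a v) < x(a v) <= x(b v) < y(b v). *)
Let a_le_b v : (0 < v < M)%R -> (a v <= b v)%R.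
Proof.
move=> v0M; rewrite /a quant_le//; apply: le_trans (cumul_le _).
by rewrite cumul_b.
Qed.

(* Inverse transform martingale coupling (Jourdain-Margheriti): as the masses
   dp (where y < x) and dn (where x < y) are balanced, [partner] matches the
   [v]-quantile of one with the [v]-quantile of the other. Replacing [y u] by
   [y (partner u)] with probability [weight u] yields the conditional mean [x u],
   and the law of [y] is preserved because the exchange between [u] and
   [partner u] is symmetric. *)
Definition partner u : R :=
  if (0 < dp u)%R then b (cumul mp u) else a (cumul mn u).

Lemma measurable_partner : measurable_fun setT partner.
Proof.
apply: measurable_fun_if => //.
- by apply: measurable_fun_ltr => //; exact: measurable_excess.
- apply: measurable_funTS; apply: measurableT_comp; last exact: measurable_cumul.
  exact: (measurable_quant mnT).
- apply: measurable_funTS; apply: measurableT_comp; last exact: measurable_cumul.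
  exact: (measurable_quant mpT).
Qed.

Let measurable_pairing (K : R * R -> \bar R) (f g : R -> R) :
  measurable_fun setT K -> measurable_fun setT f -> measurable_fun setT g ->
  measurable_fun [set: R] (fun u => K (f u, g u)).
Proof. by move=> mK mf mg; exact: (measurableT_comp mK (measurable_fun_pair mf mg)). Qed.

(* The substitution [v = cumul mp u] (resp. [v = cumul mn u]) turns the pairs
   (u, partner u) into (a v, b v) (resp. (b v, a v)). *)
Let integral_partner (K : R * R -> \bar R) : measurable_fun setT K -> (forall u, 0 <= K u) ->
  \int[leb]_u ((dp u + dn u)%:E * K (u, partner u)) =
  \int[leb]_(v in `]0%R, M[) (K (a v, b v) + K (b v, a v)).
Proof.
move=> mK K0.
have mid : measurable_fun setT (@idfun R) := @measurable_id _ R _.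
have ma : measurable_fun setT a := measurable_quant mpT.
have mb : measurable_fun setT b := measurable_quant mnT.
have mdp : measurable_fun setT dp := measurable_excess mx my.
have mdn : measurable_fun setT dn := measurable_excess my mx.
have mK1 : measurable_fun setT (fun u => K (u, b (cumul mp u))).
  exact: (measurable_pairing mK mid (measurableT_comp mb (measurable_cumul mpT))).
have mK2 : measurable_fun setT (fun u => K (u, a (cumul mn u))).
  exact: (measurable_pairing mK mid (measurableT_comp ma (measurable_cumul mnT))).
have mdE (f : R -> R) (g : R -> \bar R) : measurable_fun setT f -> measurable_fun setT g ->
    measurable_fun [set: R] (fun u => (f u)%:E * g u).
  by move=> mf mg; apply: emeasurable_funM => //; exact/measurable_EFinP.
transitivity (\int[leb]_u ((dp u)%:E * K (u, b (cumul mp u)) +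
    (dn u)%:E * K (u, a (cumul mn u)))).
  apply: eq_integral => u _; rewrite /partner.
  case: ifPn => [p0|]; first by rewrite (excess_disj p0) addr0 mul0e adde0.
  rewrite -leNgt => p0; have -> : dp u = 0%R.
    by apply/eqP; rewrite eq_le p0 excess_ge0.
  by rewrite add0r mul0e add0e.
rewrite ge0_integralD//; last 4 first.
- by move=> u _; rewrite mule_ge0// lee_fin excess_ge0.
- exact: mdE mdp mK1.
- by move=> u _; rewrite mule_ge0// lee_fin excess_ge0.
- exact: mdE mdn mK2.
rewrite (ge0_integral_excess mx my ix iy mK1)// (ge0_integral_excess my mx iy ix mK2)//.
rewrite -/mp -/mn total_mn -/M -/a -/b ge0_integralD//; last 2 first.
- exact: measurable_funTS (measurable_pairing mK ma mb).
- exact: measurable_funTS (measurable_pairing mK mb ma).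
congr (_ + _); apply: eq_integral => v; rewrite inE/= in_itv/= => v0M.
  by rewrite cumul_a.
by rewrite cumul_b.
Qed.

(** By [integral_partner] each side sums over the pairs (a v, b v) and (b v, a v), a family
    invariant under the swap. *)
Let integral_partnerC (K : R * R -> \bar R) : measurable_fun setT K -> (forall u, 0 <= K u) ->
  \int[leb]_u ((dp u + dn u)%:E * K (u, partner u)) =
  \int[leb]_u ((dp u + dn u)%:E * K (partner u, u)).
Proof.
move=> mK K0; pose K' (w : R * R) := K (w.2, w.1).
have mK' : measurable_fun setT K'.
  exact: (measurableT_comp mK (measurable_fun_pair measurable_snd measurable_fst)).
have := integral_partner mK' (fun w => K0 (w.2, w.1)).
rewrite /K' /= => ->; rewrite (integral_partner mK K0).
by apply: eq_integral => v _; rewrite addeC.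
Qed.

(** The sign and order relations that, [x] being monotone, place [x u] strictly between [y u] and
    [y u']. *)
Let good u u' := ((0 < dp u) && (0 < dn u') && (u <= u') ||
  (0 < dn u) && (0 < dp u') && (u' <= u))%R.

Let measurable_good : measurable_fun setT (fun w : R * R => good w.1 w.2).
Proof.
have mdp : measurable_fun setT dp := measurable_excess mx my.
have mdn : measurable_fun setT dn := measurable_excess my mx.
have m1 (f : R -> R) : measurable_fun setT f -> measurable_fun setT (fun w : R * R => f w.1).
  by move=> mf; exact: (measurableT_comp mf measurable_fst).
have m2 (f : R -> R) : measurable_fun setT f -> measurable_fun setT (fun w : R * R => f w.2).
  by move=> mf; exact: (measurableT_comp mf measurable_snd).
have mi : measurable_fun setT (@idfun R) by exact: measurable_id.
have mc : measurable_fun setT (fun _ : R * R => 0%R : R) by exact: measurable_cst.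
apply: measurable_or; (apply: measurable_and; first apply: measurable_and).
- exact: (measurable_fun_ltr mc (m1 _ mdp)).
- exact: (measurable_fun_ltr mc (m2 _ mdn)).
- exact: (measurable_fun_ler (m1 _ mi) (m2 _ mi)).
- exact: (measurable_fun_ltr mc (m1 _ mdn)).
- exact: (measurable_fun_ltr mc (m2 _ mdp)).
- exact: (measurable_fun_ler (m2 _ mi) (m1 _ mi)).
Qed.

(** The indicator [K] of failing pairs has integral 0 against [dp + dn]: after substitution it is
    evaluated at (a v, b v) and (b v, a v), which are good for almost every [v] by
    [excess_quant_gt0] and [a_le_b]. *)
Let good_partner : {ae leb, forall u, (0 < dp u + dn u)%R -> good u (partner u)}.
Proof.
pose K (w : R * R) : \bar R := (~~ good w.1 w.2)%:R%:E.
have mK : measurable_fun setT K.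
  apply/measurable_EFinP.
  rewrite (_ : (fun _ => _) = (fun w => if good w.1 w.2 then 0%R else 1%R)); last first.
    by apply/funext => w; case: good.
  by apply: measurable_fun_ifT => //; exact: measurable_good.
have K0 w : 0 <= K w by rewrite lee_fin.
have mdp : measurable_fun setT dp := measurable_excess mx my.
have mdn : measurable_fun setT dn := measurable_excess my mx.
have mf : measurable_fun [set: measurableTypeR R] (fun u => (dp u + dn u)%:E * K (u, partner u)).
  apply: emeasurable_funM; first by apply/measurable_EFinP; exact: measurable_funD.
  exact: (measurable_pairing mK (@measurable_id _ R _) measurable_partner).
have : \int[leb]_u `|(dp u + dn u)%:E * K (u, partner u)| = 0.
  under eq_integral do rewrite gee0_abs ?mule_ge0// ?lee_fin ?addr_ge0 ?excess_ge0//.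
  rewrite integral_partner//.
  have [N1 [mN1 N10 sN1]] := excess_quant_gt0 mx my ix iy.
  have [N2 [mN2 N20 sN2]] := excess_quant_gt0 my mx iy ix.
  have mI : measurable (`]0%R, M[ : set (measurableTypeR R)) by exact: measurable_itv.
  have ma : measurable_fun setT a := measurable_quant mpT.
  have mb : measurable_fun setT b := measurable_quant mnT.
  rewrite (@ae_eq_integral _ _ _ leb _ (cst 0)) ?integral0//.
    apply: measurable_funTS.
    exact: (emeasurable_funD (measurable_pairing mK ma mb) (measurable_pairing mK mb ma)).
  exists (N1 `|` N2); split; first exact: measurableU.
    by apply/eqP; rewrite -measure_le0; apply: (le_trans (measureU2 _ mN1 mN2));
      rewrite [X in X + _]N10 [X in _ + X]N20 adde0.
  move=> v /= H; have [v1|v1] := pselect (N1 v); [by left|right].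
  apply: sN2 => /= H2; apply: H => v0M; rewrite in_itv/= in v0M.
  have a0 : (0 < dp (a v))%R.
    by have [//|] := pselect (0 < dp (a v))%R => na; case: v1; apply: sN1 => /= /(_ v0M).
  have b0 : (0 < dn (b v))%R by apply: H2; rewrite total_mn.
  have g1 : good (a v) (b v) by apply/orP; left; apply/andP; split; [apply/andP|exact: a_le_b].
  have g2 : good (b v) (a v) by apply/orP; right; apply/andP; split; [apply/andP|exact: a_le_b].
  have KE w : good w.1 w.2 -> K w = 0 by rewrite /K => ->.
  by rewrite (KE (a v, b v) g1) (KE (b v, a v) g2) adde0.
move/ae_eq_integral_abs => /(_ measurableT mf) [N [mN N0 sN]].
exists N; split => // u /= nG; apply: sN => /= /(_ Logic.I); apply: contra_not nG => /eqP H D0.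
apply: contraT => ng; move: H.
by rewrite /K /= ng mule1 gt_eqF.
Qed.

(** On the unit interval [dp + dn] is |x - y|, so this is the barycentric weight of y(partner u)
    that moves the mean from y u to x u; it is 0 where they already agree. *)
Definition weight u := ((dp u + dn u) * `|y (partner u) - y u|^-1)%R.

Lemma measurable_weight : measurable_fun setT weight.
Proof.
have mdp : measurable_fun setT dp := measurable_excess mx my.
have mdn : measurable_fun setT dn := measurable_excess my mx.
apply: measurable_funM; first exact: measurable_funD.
apply: measurable_inv_norm; apply: measurable_funB => //.
by apply: (measurableT_comp my); exact: measurable_partner.
Qed.

Lemma weight_ge0 u : (0 <= weight u)%R.
Proof. by rewrite mulr_ge0 ?invr_ge0// addr_ge0// excess_ge0. Qed.

Lemma weight_mean : {ae leb, forall u, (0 < u < 1)%R ->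
  (weight u <= 1)%R /\ (y u + weight u * (y (partner u) - y u) = x u)%R}.
Proof.
have [N [mN N0 sN]] := good_partner; exists N; split => // u /= nH; apply: sN => /= H.
apply: nH => u01.
have [D0|] := ltP 0%R (dp u + dn u)%R; last first.
  have := excess_ge0 x y u; have := excess_ge0 y x u; rewrite -/dp -/dn => p0 n0 s0.
  have := excess_sub u01; rewrite /weight (_ : dp u + dn u = 0)%R ?mul0r; lra.
have := H D0; rewrite /weight => /orP[/andP[/andP[p0 n0] uu]|/andP[/andP[n0 p0] uu]].
(* Here y u < x u <= x u' < y u', with u' the partner of u; the second case is the mirror image. *)
- have [_ pE] := excess_gt0 p0; have [/andP[v0 v1] nE] := excess_gt0 n0.
  have /andP[u0 u1] := u01; have nd := ndx u0 uu v1.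
  rewrite (excess_disj p0) addr0; move: p0 n0; rewrite /dp /dn pE nE => p0 n0.
  rewrite gtr0_norm; last by lra.
  rewrite ler_pdivrMr; last by lra.
  by rewrite divfK; [lra|apply/eqP; lra].
- have dp0 : dp u = 0%R.
    apply/eqP; rewrite eq_le excess_ge0 andbT leNgt; apply/negP => /excess_disj.
    by move: n0 => /[swap] ->; rewrite ltxx.
  have [_ nE] := excess_gt0 n0; have [/andP[v0 v1] pE] := excess_gt0 p0.
  have /andP[u0 u1] := u01; have nd := ndx v0 uu u1.
  rewrite dp0 add0r; move: p0 n0; rewrite /dp /dn pE nE => p0 n0.
  rewrite ltr0_norm; last by lra.
  rewrite ler_pdivrMr; last by lra.
  split; first by lra.
  by rewrite invrN mulrN mulNr divfK; [lra|apply/eqP; lra].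
Qed.

(** The factor 1/|y(partner u) - y u| is symmetric in the pair, so [integral_partnerC] applies: mass
    leaving a point for its partner is offset by mass coming back. *)
Lemma integral_weight (g : R -> \bar R) : measurable_fun setT g -> (forall u, 0 <= g u) ->
  \int[leb]_u ((weight u)%:E * g (y (partner u))) = \int[leb]_u ((weight u)%:E * g (y u)).
Proof.
move=> mg g0.
have := @integral_partnerC (fun u => `|y u.2 - y u.1|^-1%:E * g (y u.2)) _ _.
rewrite /= => H.
under eq_integral do rewrite /weight EFinM -muleA.
rewrite H//; last 2 first.
- apply: emeasurable_funM; last first.
    by apply: (measurableT_comp mg); apply: (measurableT_comp my).
  apply/measurable_EFinP; apply: measurable_inv_norm.
  by apply: measurable_funB => //; apply: (measurableT_comp my).
- by move=> u; rewrite mule_ge0// lee_fin invr_ge0.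
by apply: eq_integral => u _; rewrite /weight EFinM -muleA distrC.
Qed.

Lemma weight_out u : ~~ (0 < u < 1)%R -> weight u = 0%R.
Proof.
move=> u01; have nI : u \notin I01 by rewrite notin_setE/= in_itv; exact/negP.
by rewrite /weight /dp /dn /excess !patchE (negbTE nI) addr0 mul0r.
Qed.

(** The bound by 1 on [weight] holds only almost everywhere; the cap yields a probability at every
    point, as the randomized choice requires. *)
Definition capped_weight u := Num.min (weight u) 1%R.

Lemma measurable_capped_weight : measurable_fun setT capped_weight.
Proof. by apply: measurable_minr => //; exact: measurable_weight. Qed.

Lemma capped_weight_01 u : (0 <= capped_weight u <= 1)%R.
Proof. by rewrite /capped_weight le_min weight_ge0 ler01 ge_min lexx orbT. Qed.

Lemma capped_weight_mean : {ae leb, forall u, (0 < u < 1)%R ->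
  (y u + capped_weight u * (y (partner u) - y u) = x u)%R}.
Proof.
have [N [mN N0 sN]] := weight_mean; exists N; split => // u /= nH; apply: sN => /= H.
by apply: nH => u01; have [w1 <-] := H u01; rewrite /capped_weight (min_idPl _).
Qed.

Let integral_capped_weightE (h : R -> \bar R) : measurable_fun [set: R] h -> (forall u, 0 <= h u) ->
  \int[leb]_(u in I01) ((capped_weight u)%:E * h u) = \int[leb]_u ((weight u)%:E * h u).
Proof.
move=> mh h0; transitivity (\int[leb]_(u in I01) ((weight u)%:E * h u)); last first.
  rewrite integral_mkcond; apply: eq_integral => u _; rewrite patchE; case: ifPn => //.
  by rewrite notin_setE/= in_itv/= => /negP /weight_out ->; rewrite mul0e.
have mw (f : R -> R) : measurable_fun [set: R] f -> measurable_fun [set: R] (fun u => (f u)%:E * h u).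
  by move=> mf; apply: emeasurable_funM => //; exact/measurable_EFinP.
apply: ge0_ae_eq_integral => //.
- exact: measurable_funTS (mw _ measurable_capped_weight).
- exact: measurable_funTS (mw _ measurable_weight).
- by move=> u _; rewrite mule_ge0// lee_fin; have /andP[] := capped_weight_01 u.
- by move=> u _; rewrite mule_ge0// lee_fin weight_ge0.
- have [N [mN N0 sN]] := weight_mean; exists N; split => // u /= nH; apply: sN => /= H.
  apply: nH; rewrite in_itv/= => u01; have [w1 _] := H u01.
  by rewrite /capped_weight (min_idPl _).
Qed.

Lemma integral_capped_weight (g : R -> \bar R) :
  measurable_fun setT g -> (forall u, 0 <= g u) ->
  \int[leb]_(u in I01) ((capped_weight u)%:E * g (y (partner u))) =
  \int[leb]_(u in I01) ((capped_weight u)%:E * g (y u)).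
Proof.
move=> mg g0; rewrite (@integral_capped_weightE (fun u => g (y (partner u))))//; last first.
  exact: (measurableT_comp mg (measurableT_comp my measurable_partner)).
rewrite integral_weight//; apply/esym; apply: (@integral_capped_weightE (g \o y)).
  exact: (measurableT_comp mg my).
by move=> u; exact: g0.
Qed.

End martingale_coupling_on_01.

(** * The uniform law used for auxiliary coordinates *)

Section uniform01.
Context {R : realType}.
Local Notation leb := (@lebesgue_measure R).
Local Notation I01 := (`]0%R, 1%R[%classic : set R).

Let mI01 : measurable (I01 : set (measurableTypeR R)). Proof. exact: measurable_itv. Qed.

Let lebI : {measure set (measurableTypeR R) -> \bar R} := mrestr leb mI01.

Let lebI_ssa : semi_sigma_additive (lebI : set R -> \bar R).
Proof. exact: (@measure_semi_sigma_additive _ _ _ lebI). Qed.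

Let lebI_setT : lebI (setT : set R) = 1.
Proof.
rewrite /lebI /= /mrestr setTI.
by rewrite [LHS]lebesgue_measure_itv/= lte_fin ltr01 -EFinB subr0.
Qed.

Definition unif01 (A : set R) : \bar R := leb (A `&` I01).

HB.instance Definition _ :=
  isMeasure.Build _ R R unif01 (measure0 lebI) (measure_ge0 lebI) lebI_ssa.

HB.instance Definition _ := Measure_isProbability.Build _ R R unif01 lebI_setT.

Lemma unif01E (A : set R) : unif01 A = leb (A `&` I01).
Proof. by []. Qed.

Lemma unif01_le s : (0 <= s <= 1)%R -> unif01 [set v | v <= s]%R = s%:E.
Proof.
move=> s01; rewrite unif01E.
have [->|s1] := eqVneq s 1%R.
  rewrite (_ : _ `&` _ = I01); last first.
    by apply/seteqP; split=> v /=; rewrite in_itv/= => H; [case: H|split]; lra.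
  by rewrite [LHS]lebesgue_measure_itv/= lte_fin ltr01 -EFinB subr0.
rewrite (_ : _ `&` _ = `]0%R, s]%classic); last first.
  apply/seteqP; split=> v /=; rewrite !in_itv/= => H; first by lra.
  have : (s < 1)%R by rewrite lt_neqAle s1; lra.
  by move=> ?; split; lra.
rewrite [LHS]lebesgue_measure_itv/= lte_fin -EFinB subr0.
by case: ltP => // s0; congr EFin; lra.
Qed.

Lemma unif01_lt_le s : (0 <= s)%R -> unif01 [set v | v < s]%R <= s%:E.
Proof.
move=> s0; have [s1|s1] := leP s 1%R.
  rewrite -(@unif01_le s) ?s0//; apply: le_measure; rewrite ?inE.
  - by rewrite (_ : [set v | _] = `]-oo, s[%classic)//; apply/seteqP; split=> v /=; rewrite in_itv.
  - by rewrite (_ : [set v | _] = `]-oo, s]%classic)//; apply/seteqP; split=> v /=; rewrite in_itv.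
  - by move=> v /=; exact: ltW.
apply: (@le_trans _ _ 1); last by rewrite lee_fin ltW.
apply: probability_le1.
by rewrite (_ : [set v | _] = `]-oo, s[%classic)//; apply/seteqP; split=> v /=; rewrite in_itv.
Qed.

End uniform01.

(** * Distributional transform: a uniform variable attached to a possibly atomic one *)

Section distributional_transform.
Context d (T : measurableType d) (R : realType) (P : probability T R).
Variable Z : {RV P >-> R}.
Local Notation leb := (@lebesgue_measure R).
Local Notation I01 := (`]0%R, 1%R[%classic : set R).
Let mu : {measure set R -> \bar R} := distribution P Z.
Let F x : R := cumul mu x.
Let Fm x : R := fine (mu `]-oo, x[%classic).

(** [Fm] is the left limit of the cdf [F]. The uniform coordinate [w.2] spreads an atom of the law
    over the corresponding jump; away from atoms the value is F(Z). *)
Definition dist_transform (w : T * R) : R := (Fm (Z w.1) + w.2 * (F (Z w.1) - Fm (Z w.1)))%R.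
Local Notation U := dist_transform.

Let muT : mu setT < +oo.
Proof.
have E : mu setT = 1 := @probability_setT _ _ _ (distribution P Z).
by rewrite E ltry.
Qed.

Let FmE x : (Fm x)%:E = mu `]-oo, x[%classic.
Proof. by rewrite fineK// ge0_fin_numE// finite_mass. Qed.

Let Fm_nd x y : (x <= y)%R -> (Fm x <= Fm y)%R.
Proof.
move=> xy; rewrite -lee_fin !FmE le_measure ?inE//.
by apply: subitvPr; rewrite bnd_simp.
Qed.

Let Fm_le x : (Fm x <= F x)%R.
Proof.
rewrite -lee_fin FmE cumulE// le_measure ?inE//.
by apply: subitvPr; rewrite bnd_simp.
Qed.

Let Fm_ge x y : (x < y)%R -> (F x <= Fm y)%R.
Proof.
move=> xy; rewrite -lee_fin FmE cumulE// le_measure ?inE//.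
by apply: subitvPr; rewrite bnd_simp.
Qed.

Let jump x : (F x - Fm x)%:E = mu [set x].
Proof.
have key : (F x)%:E = (Fm x)%:E + mu [set x].
  rewrite FmE /F cumulE// -(@setUitv1 _ _ -oo%O x true)// measureU//.
  by rewrite -subset0 => t [] /=; rewrite in_itv/= => + tx; rewrite tx ltxx.
by rewrite EFinB key addeAC subee// add0e.
Qed.

Lemma measurable_dist_transform : measurable_fun setT U.
Proof.
have mF : measurable_fun setT (F \o Z) by apply: measurableT_comp => //; exact: measurable_cumul.
have mFm : measurable_fun setT (Fm \o Z).
  by apply: measurableT_comp => //; apply: nondecreasing_measurable.
have m1 (f : T -> R) : measurable_fun setT f -> measurable_fun setT (fun w : T * R => f w.1).
  by move=> mf; exact: (measurableT_comp mf measurable_fst).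
apply: measurable_funD; first exact: (m1 _ mFm).
apply: measurable_funM; first exact: measurable_snd.
by apply: measurable_funB; [exact: (m1 _ mF)|exact: (m1 _ mFm)].
Qed.

Let quant_bounds c : (0 < c < 1)%R -> (Fm (rv_quant Z c) <= c <= F (rv_quant Z c))%R.
Proof.
move=> c01; apply/andP; split.
  rewrite -lee_fin FmE; apply: mass_lt_quant => //.
  by rewrite /total_mass (@probability_setT _ _ _ (distribution P Z) : mu setT = 1).
by have := lexx (rv_quant Z c); rewrite rv_quant_le// => H; rewrite -lee_fin cumulE.
Qed.

(* At an atom [z] of the law of [Z] the variable is spread over the jump of the
   cdf; [s] is the fraction of the jump lying below [c]. *)
Let jump_fraction c : (0 < c < 1)%R -> exists2 s, (0 <= s <= 1)%R &
  let z := rv_quant Z c in [/\ (Fm z + s * (F z - Fm z) = c)%R,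
    forall v, (v <= s)%R -> (v * (F z - Fm z) <= c - Fm z)%R &
    forall v, (0 < v < 1)%R -> (v * (F z - Fm z) < c - Fm z)%R -> (v < s)%R].
Proof.
move=> c01; set z := rv_quant Z c; have /andP[zc cz] := quant_bounds c01.
have [J0|J0] := eqVneq (F z - Fm z)%R 0%R.
  exists 1%R; first by lra.
  split=> [|v _|v v01 _]; rewrite ?J0 ?mulr0; by [move: J0; lra|lra].
have Jp : (0 < F z - Fm z)%R by rewrite lt_neqAle eq_sym J0 subr_ge0 Fm_le.
exists ((c - Fm z) / (F z - Fm z))%R.
  by rewrite divr_ge0 ?ler_pdivrMr//; lra.
split=> [|v|v _]; rewrite ?ler_pdivlMr ?ltr_pdivlMr//.
by rewrite divfK//; lra.
Qed.

Let U_range (w : T * R) : (0 <= w.2 <= 1)%R -> (Fm (Z w.1) <= U w <= F (Z w.1))%R.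
Proof.
move=> /andP[w0 w1]; have := Fm_le (Z w.1); rewrite /U => H.
have := mulr_ge0 w0 (_ : 0 <= F (Z w.1) - Fm (Z w.1))%R; rewrite subr_ge0 => /(_ H) H1.
have := mulr_ge0 (_ : 0 <= 1 - w.2)%R (_ : 0 <= F (Z w.1) - Fm (Z w.1))%R.
by rewrite !subr_ge0 => /(_ w1 H) H2; apply/andP; split; nra.
Qed.

(** With z = [rv_quant Z c], the indicator of Z < z plus [s] times that of Z = z is compared with
    the conditional probability, given the first coordinate, that U lies below c. Its integral is
    exactly c for the [s] of [jump_fraction]. *)
Let below c t : \bar R :=
  (\1_[set x | x < rv_quant Z c]%R (Z t))%:E.
Let at_ c t : \bar R := (\1_[set rv_quant Z c] (Z t))%:E.

Let m_lt (x : R) : measurable [set y | y < x]%R.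
Proof. by rewrite (_ : [set v | _] = `]-oo, x[%classic)//; apply/seteqP; split=> v /=; rewrite in_itv. Qed.

Let m_le (x : R) : measurable [set y | y <= x]%R.
Proof. by rewrite (_ : [set v | _] = `]-oo, x]%classic)//; apply/seteqP; split=> v /=; rewrite in_itv. Qed.

Let measurable_below c : measurable_fun setT (below c).
Proof.
apply/measurable_EFinP.
exact: (measurableT_comp (measurable_indic (m_lt (rv_quant Z c))) (measurable_funPT Z)).
Qed.

Let measurable_at c : measurable_fun setT (at_ c).
Proof.
apply/measurable_EFinP.
exact: (measurableT_comp (measurable_indic (@measurable_set1 R (rv_quant Z c))) (measurable_funPT Z)).
Qed.

Let measurable_bound c s : measurable_fun setT (fun t => below c t + s%:E * at_ c t).
Proof.
apply: emeasurable_funD; first exact: measurable_below.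
by apply: emeasurable_funM => //; exact: measurable_at.
Qed.

Let bound_ge0 c s t : (0 <= s)%R -> 0 <= below c t + s%:E * at_ c t.
Proof. by move=> s0; rewrite adde_ge0 ?mule_ge0 ?lee_fin. Qed.

Let integral_bounds c s : (0 <= s)%R ->
  \int[P]_t (below c t + s%:E * at_ c t) =
  (Fm (rv_quant Z c) + s * (F (rv_quant Z c) - Fm (rv_quant Z c)))%:E.
Proof.
move=> s0; have mb : measurable_fun setT (below c).
  exact: measurable_below.
have ma : measurable_fun setT (at_ c).
  exact: measurable_at.
rewrite ge0_integralD//; last 3 first.
- by move=> t _; rewrite lee_fin.
- by move=> t _; rewrite mule_ge0 ?lee_fin.
- by apply: emeasurable_funM.
rewrite ge0_integralZl//; try by move=> t _; rewrite lee_fin.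
rewrite EFinD EFinM jump FmE; congr (_ + _ * _).
  rewrite -(@ge0_integral_distribution _ _ _ _ _ P Z (fun x => (\1_[set x | x < rv_quant Z c]%R x)%:E))//.
    rewrite integral_indic// setIT; congr (_ _); apply/seteqP; split=> v /=; by rewrite in_itv.
  by apply/measurable_EFinP; apply: measurable_indic.
rewrite -(@ge0_integral_distribution _ _ _ _ _ P Z (fun x => (\1_[set rv_quant Z c] x)%:E))//.
by rewrite integral_indic// setIT.
by apply/measurable_EFinP; apply: measurable_indic; exact: measurable_set1.
Qed.

Let PU := (P \x unif01)%E.

Let PUE A : measurable A -> PU A = \int[P]_t unif01 (xsection A t).
Proof. by []. Qed.

(** Argued section by section: for Z < z the bound is 1; for Z > z the section is empty, as U >= F z
    >= c there; at Z = z it lies below the fraction [s] of the jump. With the companion bound on U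
    <= c this pins down the law of U. *)
Let dist_transform_lt c : (0 < c < 1)%R -> PU [set w | U w < c]%R <= c%:E.
Proof.
move=> c01; have [s s01 [sE s1 s2]] := jump_fraction c01.
have mA : measurable [set w | U w < c]%R.
  by have := measurable_dist_transform measurableT (m_lt c); rewrite setTI.
have /andP[s0 _] := s01; have E := @integral_bounds c s s0; rewrite sE in E.
rewrite PUE// -E.
apply: ge0_le_integral => //; try exact: measurable_fun_xsection;
  try exact: measurable_bound; try by move=> t _; exact: bound_ge0.
move=> t _; have [tz|zt|tz] := ltgtP (Z t) (rv_quant Z c).
- apply: (@le_trans _ _ 1).
    by apply: probability_le1; exact: measurable_xsection.
  rewrite /below indicE mem_set//= leeDl// mule_ge0// ?lee_fin//; by case/andP: s01.
- rewrite (_ : unif01 _ = 0); first by rewrite adde_ge0 ?mule_ge0 ?lee_fin//; case/andP: s01.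
  rewrite unif01E.
  rewrite (_ : _ `&` _ = set0) ?measure0// -subset0 => v [] /=.
  rewrite /xsection /= inE/= in_itv/= => + v01.
  have /U_range/andP[+ _] : (0 <= (t, v).2 <= 1)%R by rewrite /=; lra.
  have := Fm_ge zt; have := quant_bounds c01; rewrite /=; lra.
- rewrite /below /at_ !indicE memNset ?add0e ?mem_set//= ?mule1; last by rewrite tz ltxx.
  apply: le_trans (@unif01_lt_le _ s s0); rewrite !unif01E; apply: le_measure; rewrite ?inE.
  + by apply: measurableI; [exact: measurable_xsection|exact: measurable_itv].
  + by apply: measurableI; [exact: m_lt|exact: measurable_itv].
  + move=> v [] /=; rewrite /xsection /= inE/= in_itv/= /U /= tz => H v01; split => //.
    by apply: s2 => //; lra.
Qed.

Let dist_transform_le c : (0 < c < 1)%R -> c%:E <= PU [set w | U w <= c]%R.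
Proof.
move=> c01; have [s s01 [sE s1 s2]] := jump_fraction c01.
have mA : measurable [set w | U w <= c]%R.
  by have := measurable_dist_transform measurableT (m_le c); rewrite setTI.
have /andP[s0 _] := s01; have E := @integral_bounds c s s0; rewrite sE in E.
rewrite PUE// -E.
apply: ge0_le_integral => //; try exact: measurable_fun_xsection;
  try exact: measurable_bound; try by move=> t _; exact: bound_ge0.
move=> t _; rewrite /below /at_ !indicE; have [tz|zt|tz] := ltgtP (Z t) (rv_quant Z c).
- rewrite mem_set// memNset/=; last by move=> tE; rewrite tE ltxx in tz.
  rewrite mule0 adde0 -(@unif01_le R 1%R) ?ler01 ?lexx// !unif01E.
  apply: le_measure; rewrite ?inE.
  + by apply: measurableI; [exact: m_le|exact: measurable_itv].
  + by apply: measurableI; [exact: measurable_xsection|exact: measurable_itv].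
  + move=> v [] /= v1; rewrite in_itv/= => v01; split => //; rewrite /xsection /= inE/=.
    have /U_range/andP[_ +] : (0 <= (t, v).2 <= 1)%R by rewrite /=; lra.
    have := Fm_ge tz; have := quant_bounds c01; rewrite /=; lra.
- rewrite !memNset/= ?mule0 ?add0e//; last by move/ltW; rewrite leNgt zt.
  by move=> tE; rewrite tE ltxx in zt.
- rewrite memNset ?add0e ?mem_set//= ?mule1; last by rewrite tz ltxx.
  rewrite -(unif01_le s01); apply: le_measure; rewrite ?inE.
  + exact: m_le.
  + exact: measurable_xsection.
  + move=> v /= /s1 H; rewrite /xsection /= inE/= /U /= tz; lra.
Qed.

HB.instance Definition _ :=
  isMeasurableFun.Build _ _ _ _ dist_transform measurable_dist_transform.

Lemma rv_quant_uniform t : (0 < t < 1)%R ->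
  rv_quant (dist_transform : {RV PU >-> R}) t = t.
Proof.
move=> t01; set q := rv_quant _ t.
have cdfE x : cdf (dist_transform : {RV PU >-> R}) x = PU [set w | U w <= x]%R.
  by congr (PU _); apply/seteqP; split => w /=; rewrite in_itv.
apply/eqP; rewrite eq_le; apply/andP; split.
  by rewrite rv_quant_le// cdfE; exact: dist_transform_le.
rewrite leNgt; apply/negP => qt.
have := lexx q; rewrite {1}/q rv_quant_le// cdfE.
(* A level strictly between [q] and [t], kept positive by the maximum with 0, for the contradiction
   t <= P(U <= q) <= P(U < c) <= c < t. *)
pose c := ((Num.max q 0 + t) / 2)%R.
have cE : (q < c)%R /\ (0 < c < t)%R.
  by rewrite /c; have [q0|q0] := leP q 0%R; lra.
case: cE => qc /andP[c0 ct].
have c01 : (0 < c < 1)%R by lra.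
move=> tq; have H : PU [set w | U w <= q]%R <= PU [set w | U w < c]%R.
  apply: le_measure; rewrite ?inE.
  - by have := measurable_dist_transform measurableT (m_le q); rewrite setTI.
  - by have := measurable_dist_transform measurableT (m_lt c); rewrite setTI.
  - by move=> w /= wq; exact: le_lt_trans qc.
have := le_trans tq (le_trans H (dist_transform_lt c01)).
by rewrite lee_fin => tc; have := lt_le_trans ct tc; rewrite ltxx.
Qed.

Lemma ge0_integral_dist_transform (g : R -> \bar R) :
  measurable_fun setT g -> (forall u, 0 <= g u) ->
  \int[PU]_w g (U w) = \int[leb]_(t in I01) g t.
Proof.
move=> mg g0; apply: etrans (ge0_integral_rv_quant (dist_transform : {RV PU >-> R}) mg g0) _.
by apply: eq_integral => t; rewrite inE/= in_itv/= => t01; rewrite rv_quant_uniform.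
Qed.

(** As [U] is uniform, Lebesgue-null sets have null preimages; adding the complement of the unit
    interval to the exceptional set also gives 0 < U < 1. *)
Lemma ae_dist_transform (p : R -> Prop) : {ae leb, forall u, (0 < u < 1)%R -> p u} ->
  {ae PU, forall w, (0 < U w < 1)%R /\ p (U w)}.
Proof.
move=> [N [mN N0 sN]]; pose B : set R := ~` I01 `|` N.
have mB : measurable B.
  by apply: measurableU; [apply: measurableC; exact: measurable_itv|exact: mN].
have mUB : measurable (U @^-1` B).
  by have := measurable_dist_transform measurableT mB; rewrite setTI.
exists (U @^-1` B); split => //.
- transitivity (\int[PU]_w (\1_(U @^-1` B) w)%:E); first by rewrite integral_indic// setIT.
  transitivity (\int[leb]_(u in I01) (\1_B u)%:E).
    apply: (@ge0_integral_dist_transform (fun u => (\1_B u)%:E)) => //.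
    by apply/measurable_EFinP; exact: measurable_indic.
  rewrite (@ae_eq_integral _ _ _ leb I01 (cst 0))//.
  + exact: integral0.
  + by apply/measurable_EFinP; apply: measurable_funTS; exact: measurable_indic.
  + exists N; split => // u /= H; have [//|nN] := pselect (N u).
    by case: H => uI; rewrite indicE memNset//= => -[].
- move=> w /= H; rewrite /B /=; have [wN|wN] := pselect (N (U w)); [by right|left].
  rewrite in_itv/= => w01; apply: H; split => //.
  by have [//|np] := pselect (p (U w)); case: wN; apply: sN => /= /(_ w01).
Qed.

Lemma ae_snd_unif01 : {ae PU, forall w, (0 < w.2 < 1)%R}.
Proof.
have mI : measurable (~` I01 : set R) by apply: measurableC; exact: measurable_itv.
exists (setT `*` ~` I01); split; first exact: measurableX.
  by rewrite /PU product_measure1E// [X in _ * X]unif01E setICl [X in _ * X]measure0 mule0.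
by move=> w /= H; split => //; rewrite in_itv.
Qed.

(** U <= F(Z), read through [rv_quant_le]. Comparing means later upgrades this to almost sure
    equality. *)
Lemma rv_quant_dist_transform_le :
  {ae PU, forall w, (rv_quant Z (U w) <= Z w.1)%R}.
Proof.
have [N1 [mN1 N10 sN1]] := ae_snd_unif01.
have [N2 [mN2 N20 sN2]] := @ae_dist_transform (fun=> True) (aeW _ (fun _ _ => Logic.I)).
exists (N1 `|` N2); split; first exact: measurableU.
  by apply/eqP; rewrite -measure_le0; apply: (le_trans (measureU2 _ mN1 mN2));
    rewrite [X in X + _]N10 [X in _ + X]N20 adde0.
move=> w /= H; have [w1|w1] := pselect (N1 w); [by left|right].
apply: sN2 => /= -[w01 _]; apply: H; rewrite rv_quant_le//.
have w2 : (0 < w.2 < 1)%R by have [//|nw] := pselect (0 < w.2 < 1)%R; case: w1; apply: sN1.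
have /U_range/andP[_ +] : (0 <= w.2 <= 1)%R by lra.
by rewrite -lee_fin cumulE.
Qed.

End distributional_transform.

(** * Transfer of integrals along equal laws and measure-preserving maps *)

Section transfer.
Context d1 (T1 : measurableType d1) d2 (T2 : measurableType d2) d' (T' : measurableType d').
Context (R : realType) (P1 : probability T1 R) (P2 : probability T2 R).
Variables (X1 : {RV P1 >-> T'}) (X2 : {RV P2 >-> T'}).
Hypothesis X12 : eq_distribution X1 X2.

Lemma ge0_integral_eq_distribution (f : T' -> \bar R) :
  measurable_fun setT f -> (forall x, 0 <= f x) ->
  \int[P1]_w f (X1 w) = \int[P2]_w f (X2 w).
Proof.
move=> mf f0; rewrite -(@ge0_integral_distribution _ _ _ _ _ P1 X1 f)//.
rewrite -(@ge0_integral_distribution _ _ _ _ _ P2 X2 f)//.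
by apply: eq_measure_integral => A mA _; exact: X12.
Qed.

Lemma integral_eq_distribution (f : T' -> \bar R) : measurable_fun setT f ->
  \int[P1]_w f (X1 w) = \int[P2]_w f (X2 w).
Proof.
move=> mf.
have Ep : \int[P1]_w (f^\+ \o X1) w = \int[P2]_w (f^\+ \o X2) w.
  by apply: ge0_integral_eq_distribution; [exact: measurable_funepos|exact: funepos_ge0].
have En : \int[P1]_w (f^\- \o X1) w = \int[P2]_w (f^\- \o X2) w.
  by apply: ge0_integral_eq_distribution; [exact: measurable_funeneg|exact: funeneg_ge0].
rewrite -[LHS]/(\int[P1]_w (f \o X1) w) -[RHS]/(\int[P2]_w (f \o X2) w).
rewrite integralE [RHS]integralE (funepos_comp f X1) (funeneg_comp f X1).
by rewrite (funepos_comp f X2) (funeneg_comp f X2) Ep En.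
Qed.

Lemma integrable_eq_distribution (f : T' -> \bar R) : measurable_fun setT f ->
  P1.-integrable setT (f \o X1) -> P2.-integrable setT (f \o X2).
Proof.
move=> mf /integrableP[_ i1]; apply/integrableP; split.
  exact: measurableT_comp.
rewrite -(@ge0_integral_eq_distribution (fun x => `|f x|))//.
exact: measurableT_comp.
Qed.

End transfer.

Lemma eq_distribution_sym d1 (T1 : measurableType d1) d2 (T2 : measurableType d2)
    d' (T' : measurableType d') (R : realType) (P1 : probability T1 R) (P2 : probability T2 R)
    (X1 : {RV P1 >-> T'}) (X2 : {RV P2 >-> T'}) :
  eq_distribution X1 X2 -> eq_distribution X2 X1.
Proof. by move=> H A mA; rewrite H. Qed.

Lemma ae_eq_of_le_integral d (T : measurableType d) (R : realType)
    (mu : {measure set T -> \bar R}) (f g : T -> R) :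
  mu.-integrable setT (EFin \o f) -> mu.-integrable setT (EFin \o g) ->
  {ae mu, forall x, (f x <= g x)%R} ->
  \int[mu]_x (f x)%:E = \int[mu]_x (g x)%:E -> {ae mu, forall x, f x = g x}.
Proof.
move=> if_ ig fg E.
have ifg : mu.-integrable setT (EFin \o (fun x => g x - f x)%R).
  exact: (integrableB measurableT ig if_).
have mfg := measurable_int _ ifg.
have : \int[mu]_x `|(g x - f x)%:E| = 0.
  rewrite (@ae_eq_integral _ _ _ mu _ (fun x => (g x)%:E - (f x)%:E))//.
  - rewrite integralB_EFin// E subee//.
    by apply: integrable_fin_num.
  - exact: measurableT_comp.
  - have [N [mN N0 sN]] := fg; exists N; split => // x /= nH; apply: sN => /= le; apply: nH => _.
    by rewrite ger0_norm ?subr_ge0.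
move/ae_eq_integral_abs => /(_ measurableT mfg) [N [mN N0 sN]]; exists N; split => // x /= nE.
apply: sN => /= /(_ Logic.I) [] /eqP; rewrite subr_eq0 => /eqP H; exact/nE.
Qed.

Section unif01_if.
Context {R : realType}.

Lemma integral_unif01_if (p a b : R) : (0 <= p <= 1)%R ->
  \int[unif01]_v (if (v <= p)%R then a else b)%:E = (p * a + (1 - p) * b)%:E.
Proof.
move=> p01.
have mp : measurable [set v : R | v <= p]%R.
  by rewrite (_ : [set v | _] = `]-oo, p]%classic)//; apply/seteqP; split=> v /=; rewrite in_itv.
transitivity (\int[@unif01 R]_v (b%:E + (a - b)%:E * (\1_[set v : R | v <= p]%R v)%:E)).
  apply: eq_integral => v _; rewrite indicE; case: ifPn => vp.
    by rewrite mem_set// mule1 -EFinD; congr EFin; lra.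
  by rewrite memNset ?mule0 ?adde0//; exact/negP.
have pE : (@unif01 R) [set v : R | v <= p]%R = p%:E by exact: unif01_le.
have i1 : (@unif01 R).-integrable setT (EFin \o \1_[set v : R | v <= p]%R).
  by apply: integrable_indic => //; rewrite pE ltry.
rewrite integralD//; last 2 first.
- exact: finite_measure_integrable_cst.
- exact: integrableZl.
rewrite integralZl// integral_indic// setIT [X in _ + _ * X]pE.
have := @integral_cst _ _ _ (@unif01 R) _ measurableT b%:E.
rewrite [X in _ = _ * X](@probability_setT _ _ _ (@unif01 R)) mule1 => bE.
by rewrite [X in X + _]bE -EFinM -EFinD; congr EFin; lra.
Qed.

End unif01_if.

Lemma integral_indic_preimage d (T : measurableType d) d' (T' : measurableType d') (R : realType)
    (mu : {measure set T -> \bar R}) (f : T -> T') A :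
  measurable_fun setT f -> measurable A ->
  \int[mu]_w (\1_A (f w))%:E = mu (f @^-1` A) :> \bar R.
Proof.
move=> mf mA; rewrite -[in RHS](setIT (f @^-1` A)) -integral_indic//.
by rewrite -[X in measurable X]setTI; exact: mf.
Qed.

Section ae_and.
Context d (T : measurableType d) (R : realType) (mu : {measure set T -> \bar R}).

Lemma ae_imply2 (p q r : T -> Prop) : {ae mu, forall x, p x} -> {ae mu, forall x, q x} ->
  (forall x, p x -> q x -> r x) -> {ae mu, forall x, r x}.
Proof.
move=> [N1 [mN1 N10 sN1]] [N2 [mN2 N20 sN2]] pqr.
exists (N1 `|` N2); split; first exact: measurableU.
  by apply/eqP; rewrite -measure_le0; apply: (le_trans (measureU2 _ mN1 mN2));
    rewrite [X in X + _]N10 [X in _ + X]N20 adde0.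
move=> x /= H; have [w1|w1] := pselect (N1 x); [by left|right].
apply: sN2 => /= qx; apply: H; apply: pqr => //.
by have [//|np] := pselect (p x); case: w1; apply: sN1.
Qed.

End ae_and.

Section integral_law.
Context d (T : measurableType d) d' (T' : measurableType d') (R : realType).
Variables (mu : {measure set T -> \bar R}) (nu : {measure set T' -> \bar R}) (f : T -> T').
Hypotheses (mf : measurable_fun setT f)
  (law : forall A, measurable A -> mu (f @^-1` A) = nu A).

Lemma ge0_integral_law (g : T' -> \bar R) : measurable_fun setT g -> (forall x, 0 <= g x) ->
  \int[mu]_w g (f w) = \int[nu]_x g x.
Proof.
move=> mg g0; apply: etrans (esym (ge0_integral_pushforward mf mu measurableT mg (fun x _ => g0 x))) _.
by apply: eq_measure_integral => A mA _; exact: law.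
Qed.

Lemma integral_law_setT (g : T' -> \bar R) : measurable_fun setT g ->
  \int[mu]_w g (f w) = \int[nu]_x g x.
Proof.
move=> mg.
have Ep : \int[mu]_w (g^\+ \o f) w = \int[nu]_x g^\+ x.
  by apply: ge0_integral_law; [exact: measurable_funepos|exact: funepos_ge0].
have En : \int[mu]_w (g^\- \o f) w = \int[nu]_x g^\- x.
  by apply: ge0_integral_law; [exact: measurable_funeneg|exact: funeneg_ge0].
rewrite -[LHS]/(\int[mu]_w (g \o f) w).
by rewrite integralE [RHS]integralE (funepos_comp g f) (funeneg_comp g f) Ep En.
Qed.

Lemma integral_law_set (g : T' -> \bar R) B : measurable_fun setT g -> measurable B ->
  \int[mu]_(w in f @^-1` B) g (f w) = \int[nu]_(x in B) g x.
Proof.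
move=> mg mB; rewrite [RHS]integral_mkcond -integral_law_setT; last first.
  by apply/(measurable_restrictT _ _).1 => //; exact: measurable_funTS.
by rewrite integral_mkcond; apply: eq_integral => w _; rewrite !patchE.
Qed.

Lemma integrable_law (g : T' -> \bar R) : nu.-integrable setT g ->
  mu.-integrable setT (g \o f).
Proof.
move=> /integrableP[mg ig]; apply/integrableP; split; first exact: measurableT_comp.
by rewrite (@ge0_integral_law (fun x => `|g x|))//; exact: measurableT_comp.
Qed.

End integral_law.

(** * Choosing between two values with an independent uniform *)

Section randomized_choice.
Context d (T : measurableType d) (R : realType) (P : probability T R).
Variables (p a b : T -> R).
Hypotheses (mp : measurable_fun setT p) (ma : measurable_fun setT a) (mb : measurable_fun setT b).
Hypothesis p01 : forall t, (0 <= p t <= 1)%R.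

Definition randomized_choice (w : T * R) : R := if (w.2 <= p w.1)%R then a w.1 else b w.1.

Lemma measurable_randomized_choice : measurable_fun setT randomized_choice.
Proof.
have m1 (f : T -> R) : measurable_fun setT f -> measurable_fun setT (fun w : T * R => f w.1).
  by move=> mf; exact: (measurableT_comp mf measurable_fst).
apply: measurable_fun_ifT; [|exact: (m1 _ ma)|exact: (m1 _ mb)].
exact: (measurable_fun_ler measurable_snd (m1 _ mp)).
Qed.

Lemma randomized_choice_law (A : set R) : measurable A ->
  (P \x (@unif01 R)) (randomized_choice @^-1` A) =
  \int[P]_t (p t * \1_A (a t) + (1 - p t) * \1_A (b t))%:E.
Proof.
move=> mA.
have mind : measurable_fun setT (fun r : R => (\1_A r)%:E : \bar R).
  by apply/measurable_EFinP; exact: measurable_indic.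
rewrite -(integral_indic_preimage _ measurable_randomized_choice mA).
rewrite (@fubini_tonelli1 _ _ _ _ R P (@unif01 R) (fun w => (\1_A (randomized_choice w))%:E))//.
- apply: eq_integral => t _; rewrite /fubini_F -integral_unif01_if//.
  by apply: eq_integral => v _; rewrite /randomized_choice /=; case: ifP.
- exact: (measurableT_comp mind measurable_randomized_choice).
Qed.

(** By Fubini: given the first coordinate, the choice has mean p a + (1 - p) b. Integrating over
    cylinders expresses this as a conditional expectation. *)
Lemma integral_randomized_choice B : measurable B ->
  (P \x (@unif01 R)).-integrable setT (EFin \o randomized_choice) ->
  \int[P \x (@unif01 R)]_(w in fst @^-1` B) (randomized_choice w)%:E =
  \int[P]_(t in B) (p t * a t + (1 - p t) * b t)%:E.
Proof.
move=> mB if_; rewrite integral_mkcond [RHS]integral_mkcond.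
have -> : ((fun w => (randomized_choice w)%:E) \_ (fst @^-1` B)) =
    (fun w => (\1_B w.1 * randomized_choice w)%:E).
  apply/funext => w; rewrite patchE indicE; case: ifPn => wB.
    by rewrite mem_set ?mul1r//; move: wB; rewrite inE.
  by rewrite memNset ?mul0r//; move: wB; rewrite notin_setE.
have mf := measurable_int _ if_.
rewrite -(@integral12_prod_meas1 _ _ _ _ R P (@unif01 R)
  (fun w => (\1_B w.1 * randomized_choice w)%:E)).
  apply: eq_integral => t _; rewrite /fubini_F patchE /= indicE.
  case: ifPn => _.
    rewrite -integral_unif01_if//; apply: eq_integral => v _.
    by rewrite mul1r /randomized_choice.
  by under eq_integral do rewrite mul0r; rewrite integral0.
apply: (le_integrable measurableT _ _ if_) => //.
  apply/measurable_EFinP; apply: measurable_funM; last exact/measurable_EFinP.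
  exact: (measurableT_comp (measurable_indic mB) measurable_fst).
move=> w _ /=; rewrite lee_fin normrM indicE.
by case: (_ \in _); rewrite ?normr1 ?mul1r ?normr0 ?mul0r.
Qed.

End randomized_choice.

(** * The coupling over the given probability space *)

Section martingale_coupling.
Context d (T : measurableType d) (R : realType) (P : probability T R).
Context d2 (T2 : measurableType d2) (P2 : probability T2 R).
Variables (Z : {RV P >-> R}) (Y : {RV P2 >-> R}).
Hypotheses (iZ : P.-integrable setT (EFin \o Z)) (iY : P2.-integrable setT (EFin \o Y)).
Hypothesis EZY : \int[P]_w (Z w)%:E = \int[P2]_w (Y w)%:E.
Hypothesis sZY : forall a, (0 < a < 1)%R -> (superquantile Z a <= superquantile Y a)%R.
Local Notation leb := (@lebesgue_measure R).
Local Notation I01 := (`]0%R, 1%R[%classic : set R).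

Let x := rv_quant Z.
Let y := rv_quant Y.
Let mx : measurable_fun setT x := measurable_rv_quant Z.
Let my : measurable_fun setT y := measurable_rv_quant Y.
Let ix := integrable_rv_quant iZ.
Let iy := integrable_rv_quant iY.

Let exy : (\int[leb]_(t in I01) x t = \int[leb]_(t in I01) y t)%R.
Proof.
congr fine; rewrite -(@integral_rv_quant _ _ _ _ Z EFin)//.
by rewrite -(@integral_rv_quant _ _ _ _ Y EFin).
Qed.

Let wt := capped_weight mx my.
Let y' u := y (partner mx my u).

Let mwt : measurable_fun setT wt := measurable_capped_weight mx my ix iy.
Let my' : measurable_fun setT y' := measurableT_comp my (measurable_partner mx my ix iy).

Let wt01 u : (0 <= wt u <= 1)%R := capped_weight_01 mx my u.

Let wt_mean : {ae leb, forall u, (0 < u < 1)%R -> (y u + wt u * (y' u - y u) = x u)%R}.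
Proof. exact: (capped_weight_mean mx my ix iy (@rv_quant_nd _ _ _ _ Z) exy sZY). Qed.

Let wt_integral (g : R -> \bar R) : measurable_fun setT g -> (forall u, 0 <= g u) ->
  \int[leb]_(u in I01) ((wt u)%:E * g (y' u)) = \int[leb]_(u in I01) ((wt u)%:E * g (y u)).
Proof. exact: (integral_capped_weight mx my ix iy (@rv_quant_nd _ _ _ _ Z) exy sZY). Qed.

Let PU := P \x (@unif01 R).
Let U : T * R -> R := dist_transform Z.
Let mU : measurable_fun setT U := measurable_dist_transform Z.
Let mw : measurable_fun setT (wt \o U) := measurableT_comp mwt mU.
Let ma : measurable_fun setT (y' \o U) := measurableT_comp my' mU.
Let mb : measurable_fun setT (y \o U) := measurableT_comp my mU.
Let w01 p : (0 <= (wt \o U) p <= 1)%R := wt01 (U p).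
Let mYt := measurable_randomized_choice mw ma mb.

Let Yt := randomized_choice (wt \o U) (y' \o U) (y \o U).

HB.instance Definition _ := isMeasurableFun.Build _ _ _ _ Yt mYt.

Let fst_law A : measurable A -> PU (fst @^-1` A) = P A.
Proof.
move=> mA; rewrite (_ : _ @^-1` _ = A `*` setT).
  by rewrite /PU product_measure1E// [X in _ * X](@probability_setT _ _ _ (@unif01 R)) mule1.
by apply/seteqP; split => w /=; [|case].
Qed.

Let Yt_law A : measurable A -> (PU \x (@unif01 R)) (Yt @^-1` A) = P2 (Y @^-1` A).
Proof.
move=> mA; rewrite (randomized_choice_law PU mw ma mb w01 mA).
have mind : measurable_fun setT (fun r : R => (\1_A r)%:E : \bar R).
  by apply/measurable_EFinP; exact: measurable_indic.
have ind0 (r : R) : 0 <= (\1_A r)%:E :> \bar R by rewrite lee_fin.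
rewrite -(integral_indic_preimage P2 (measurable_funPT Y) mA).
rewrite (@ge0_integral_rv_quant _ _ _ _ Y _ mind ind0) -/y.
have mr (f g : R -> R) : measurable_fun [set: R] f -> measurable_fun [set: R] g ->
    measurable_fun [set: R] (fun u => (f u)%:E * (\1_A (g u))%:E).
  move=> mf mg; apply: emeasurable_funM; first exact/measurable_EFinP.
  exact: (measurableT_comp mind mg).
have mwt1 : measurable_fun [set: R] (fun u => 1 - wt u)%R by exact: measurable_funB.
have wt1 u : (0 <= 1 - wt u)%R by have /andP[_] := wt01 u; rewrite subr_ge0.
have wt0 u : (0 <= wt u)%R by have /andP[] := wt01 u.
pose h u := ((wt u * \1_A (y' u) + (1 - wt u) * \1_A (y u))%R)%:E.
have hE u : h u = (wt u)%:E * (\1_A (y' u))%:E + (1 - wt u)%:E * (\1_A (y u))%:E by [].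
have mh : measurable_fun [set: R] h.
  exact: (emeasurable_funD (mr _ _ mwt my') (mr _ _ mwt1 my)).
have h0 u : 0 <= h u by rewrite lee_fin addr_ge0// mulr_ge0.
transitivity (\int[leb]_(t in I01) h t).
  exact: (@ge0_integral_dist_transform _ _ _ _ Z h mh h0).
under eq_integral do rewrite hE.
rewrite ge0_integralD//; last 4 first.
- by move=> u _; rewrite mule_ge0 ?lee_fin.
- exact: measurable_funTS (mr _ _ mwt my').
- by move=> u _; rewrite mule_ge0 ?lee_fin.
- exact: measurable_funTS (mr _ _ mwt1 my).
(* The exchange turns y' into y in the first term; the weights wt and 1 - wt then recombine to 1. *)
rewrite (@wt_integral (fun r => (\1_A r)%:E))// -ge0_integralD//; last 4 first.
- by move=> u _; rewrite mule_ge0 ?lee_fin.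
- exact: measurable_funTS (mr _ _ mwt my).
- by move=> u _; rewrite mule_ge0 ?lee_fin.
- exact: measurable_funTS (mr _ _ mwt1 my).
by apply: eq_integral => u _; rewrite -!EFinM -EFinD; congr EFin; lra.
Qed.

Let iYt : (PU \x (@unif01 R)).-integrable setT (EFin \o Yt).
Proof.
have law A : measurable A -> (PU \x (@unif01 R)) (Yt @^-1` A) = distribution P2 Y A.
  exact: Yt_law.
apply: (@integrable_law _ _ _ _ _ _ _ _ mYt law EFin).
apply/integrableP; split; first exact/measurable_EFinP.
rewrite (@ge0_integral_distribution _ _ _ _ _ P2 Y (fun r => `|r%:E|))//; last first.
  by apply: measurableT_comp => //; exact/measurable_EFinP.
by have /integrableP[] := iY.
Qed.

Let iZ1 : PU.-integrable setT (EFin \o (Z \o fst)).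
Proof. exact: (integrable_law (measurable_fst) fst_law iZ). Qed.

Let mxU : measurable_fun setT (x \o U) := measurableT_comp mx mU.

(** Both laws are the image of Lebesgue measure on the unit interval under [x], since [U] is uniform
    and [x] is the quantile function of [Z]. *)
Let xU_law A : measurable A -> PU ((x \o U) @^-1` A) = distribution P Z A.
Proof.
move=> mA.
have mind : measurable_fun setT (fun r : R => (\1_A r)%:E : \bar R).
  by apply/measurable_EFinP; exact: measurable_indic.
have ind0 (r : R) : 0 <= (\1_A r)%:E :> \bar R by rewrite lee_fin.
transitivity (\int[PU]_w (\1_A ((x \o U) w))%:E).
  exact: (esym (integral_indic_preimage PU mxU mA)).
transitivity (\int[P]_w (\1_A (Z w))%:E); last first.
  exact: (integral_indic_preimage P (measurable_funPT Z) mA).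
rewrite (@ge0_integral_rv_quant _ _ _ _ Z _ mind ind0) -/x.
apply: (@ge0_integral_dist_transform _ _ _ _ Z (fun u => (\1_A (x u))%:E)) => //.
exact: (measurableT_comp mind mx).
Qed.

(* [x (U p) <= Z p.1] almost surely, and both sides have the same law, hence
   the same mean. *)
Let xU_eq : {ae PU, forall p, x (U p) = Z p.1}.
Proof.
have iD : (distribution P Z).-integrable setT EFin.
  apply/integrableP; split; first exact/measurable_EFinP.
  rewrite (@ge0_integral_distribution _ _ _ _ _ P Z (fun r => `|r%:E|))//; last first.
    by apply: measurableT_comp => //; exact/measurable_EFinP.
  by have /integrableP[] := iZ.
apply: (@ae_eq_of_le_integral _ _ _ PU (x \o U) (Z \o fst)).
- exact: (integrable_law mxU xU_law iD).
- exact: iZ1.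
- exact: rv_quant_dist_transform_le.
- have mE : measurable_fun [set: R] (EFin : R -> \bar R) by exact/measurable_EFinP.
  rewrite (integral_law_setT mxU xU_law mE).
  rewrite (@integral_distribution _ _ _ _ _ P Z EFin mE iZ).
  apply/esym; apply: (integral_law_setT measurable_fst fst_law (g := EFin \o Z)).
  exact/measurable_EFinP.
Qed.

Let mean_eq : {ae PU, forall p,
  (wt (U p) * y' (U p) + (1 - wt (U p)) * y (U p))%R = Z p.1}.
Proof.
apply: (ae_imply2 xU_eq (ae_dist_transform Z wt_mean)) => p <- [_].
by rewrite -/U => <-; lra.
Qed.

Let pi (w : (T * R) * R) : T := w.1.1.

Let mpi : measurable_fun setT pi.
Proof. exact: (measurableT_comp measurable_fst measurable_fst). Qed.

HB.instance Definition _ := isMeasurableFun.Build _ _ _ _ pi mpi.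

Let pi_law A : measurable A -> (PU \x (@unif01 R)) (pi @^-1` A) = P A.
Proof.
move=> mA; rewrite (_ : _ @^-1` _ = (fst @^-1` A) `*` setT).
  rewrite product_measure1E//; last first.
    by have := @measurable_fst _ _ T R measurableT A mA; rewrite setTI.
  by rewrite [X in _ * X](@probability_setT _ _ _ (@unif01 R)) mule1; exact: fst_law.
by apply/seteqP; split => w /=; [|case].
Qed.

Let Yt_martingale B : measurable B ->
  \int[PU \x (@unif01 R)]_(w in pi @^-1` B) (Yt w)%:E = \int[P]_(t in B) (Z t)%:E.
Proof.
move=> mB.
have mpB : measurable (fst @^-1` B : set (T * R)).
  by have := @measurable_fst _ _ T R measurableT B mB; rewrite setTI.
rewrite (integral_randomized_choice w01 mpB iYt).
rewrite -(integral_law_set measurable_fst fst_law (g := EFin \o Z))//; last exact/measurable_EFinP.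
apply: ae_eq_integral => //.
- apply/measurable_EFinP; apply: measurable_funTS; apply: measurable_funD.
    exact: measurable_funM mw ma.
  by apply: measurable_funM mb; exact: measurable_funB.
- apply: measurable_funTS; apply/measurable_EFinP.
  exact: (measurableT_comp (measurable_funPT Z) measurable_fst).
- have [N [mN N0 sN]] := mean_eq; exists N; split => // p /= nE; apply: sN => /= E.
  by apply: nE => _; rewrite E.
Qed.

(** [f] pulls back the whole space, so any other variable on [T], in particular the vector X, is
    carried along with its law. The last clause says that Z composed with [f] is the conditional
    mean of Y' given [f], which is stronger than conditioning on Z alone. *)
Theorem martingale_coupling :
  exists (d' : measure_display) (T' : measurableType d') (P' : probability T' R)
      (f : {mfun T' >-> T}) (Y' : {RV P' >-> R}),
    [/\ forall A, measurable A -> P' (f @^-1` A) = P A,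
        eq_distribution Y' Y &
        forall B, measurable B ->
          \int[P']_(w in f @^-1` B) (Y' w)%:E = \int[P]_(t in B) (Z t)%:E].
Proof.
by exists _, _, (PU \x (@unif01 R)), pi, Yt; split;
  [exact: pi_law|exact: Yt_law|exact: Yt_martingale].
Qed.

End martingale_coupling.

(** * The identified set *)

Section centered_random_variables.
Context d (T : measurableType d) (R : realType) (P : probability T R).

Lemma integrable_centered (Y : {RV P >-> R}) : P.-integrable setT (EFin \o Y) ->
  P.-integrable setT (EFin \o centered P Y).
Proof.
move=> iY; apply: (@integrableB _ _ _ P _ measurableT (EFin \o Y) (cst (fine 'E_P[Y])%:E)) => //.
exact: finite_measure_integrable_cst.
Qed.

Lemma integral_centered (Y : {RV P >-> R}) : P.-integrable setT (EFin \o Y) ->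
  \int[P]_t (centered P Y t)%:E = 0.
Proof.
move=> iY; under eq_integral do rewrite EFinB.
rewrite integralB_EFin//; last exact: finite_measure_integrable_cst.
have EY : (fine 'E_P[Y])%:E = \int[P]_t (Y t)%:E.
  by rewrite expectation_def fineK//; exact: integrable_fin_num.
have := @integral_cst _ _ _ P _ measurableT (fine 'E_P[Y])%:E.
rewrite [X in _ = _ * X](@probability_setT _ _ _ P) mule1 => bE.
by rewrite [X in _ - X]bE EY subee// integrable_fin_num.
Qed.

Definition mean_tuple p (X : {RV P >-> p.-tuple R}) : p.-tuple R :=
  [tuple fine 'E_P[component X i] | i < p].

End centered_random_variables.

(** * Centering and linear forms as maps applied to the vector *)

Section shift_and_linear_form.
Context {R : realType} {p : nat}.

Definition shift_tuple (m x : p.-tuple R) : p.-tuple R := [tuple (tnth x i - tnth m i)%R | i < p].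

Definition linear_form (b : 'rV[R]_p) (x : p.-tuple R) : R := dotp (row_of_tuple x) b.

Lemma measurable_shift_tuple m : measurable_fun setT (shift_tuple m).
Proof.
apply/measurable_fun_tnthP => i.
rewrite (_ : _ \o _ = (fun x => tnth x i - tnth m i)%R); last first.
  by apply/funext => t /=; rewrite tnth_mktuple.
by apply: measurable_funB => //; exact: measurable_tnth.
Qed.

Lemma measurable_linear_form b : measurable_fun setT (linear_form b).
Proof.
apply: measurable_sum => i; apply: measurable_funM => //.
apply: eq_measurable_fun (measurable_tnth i) => t _.
by rewrite mxE.
Qed.

Lemma centered_vecE d (T : measurableType d) (P : probability T R)
    (X : {RV P >-> p.-tuple R}) :
  centered_vec P X = shift_tuple (mean_tuple X) \o X.
Proof.
by apply/funext => t; apply: eq_from_tnth => i; rewrite /= !tnth_mktuple.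
Qed.

End shift_and_linear_form.

Section eq_distribution_centered.
Context d1 (T1 : measurableType d1) d2 (T2 : measurableType d2) (R : realType).
Context (P1 : probability T1 R) (P2 : probability T2 R).

Lemma eq_distribution_expectation (Y1 : {RV P1 >-> R}) (Y2 : {RV P2 >-> R}) :
  eq_distribution Y1 Y2 -> 'E_P1[Y1] = 'E_P2[Y2].
Proof.
move=> H; rewrite !expectation_def.
by apply: (integral_eq_distribution H (f := EFin)); exact/measurable_EFinP.
Qed.

Lemma eq_distribution_comp d' (T' : measurableType d') d'' (T'' : measurableType d'')
    (X1 : {RV P1 >-> T'}) (X2 : {RV P2 >-> T'}) (f : T' -> T'')
    (Z1 : {RV P1 >-> T''}) (Z2 : {RV P2 >-> T''}) :
  measurable_fun setT f -> Z1 =1 f \o X1 -> Z2 =1 f \o X2 ->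
  eq_distribution X1 X2 -> eq_distribution Z1 Z2.
Proof.
move=> mf E1 E2 H A mA.
have mfA : measurable (f @^-1` A) by have := mf measurableT A mA; rewrite setTI.
rewrite -[LHS]/(P1 (Z1 @^-1` A)) -[RHS]/(P2 (Z2 @^-1` A)).
rewrite (_ : Z1 @^-1` A = X1 @^-1` (f @^-1` A)); last by apply/seteqP; split => t /=; rewrite E1.
rewrite (_ : Z2 @^-1` A = X2 @^-1` (f @^-1` A)); last by apply/seteqP; split => t /=; rewrite E2.
exact: (H _ mfA).
Qed.

Lemma eq_distribution_centered (Y1 : {RV P1 >-> R}) (Y2 : {RV P2 >-> R}) :
  eq_distribution Y1 Y2 ->
  eq_distribution (centered P1 Y1 : {RV P1 >-> R}) (centered P2 Y2 : {RV P2 >-> R}).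
Proof.
move=> H; apply: (@eq_distribution_comp _ _ _ _ Y1 Y2 (fun y => y - fine 'E_P2[Y2])%R) => //.
  exact: measurable_funB.
by move=> t /=; rewrite /centered (eq_distribution_expectation H).
Qed.

Context {p : nat}.
Variables (X1 : {RV P1 >-> p.-tuple R}) (X2 : {RV P2 >-> p.-tuple R}).
Hypothesis X12 : eq_distribution X1 X2.

Lemma eq_distribution_mean_tuple : mean_tuple X1 = mean_tuple X2.
Proof.
apply: eq_from_tnth => i; rewrite !tnth_mktuple.
congr fine; apply: eq_distribution_expectation.
exact: (@eq_distribution_comp _ _ _ _ X1 X2 (fun x => tnth x i) _ _ (measurable_tnth i)).
Qed.

Lemma eq_distribution_dot_rv b :
  eq_distribution (dot_rv (centered_vec P1 X1) b : {RV P1 >-> R})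
    (dot_rv (centered_vec P2 X2) b : {RV P2 >-> R}).
Proof.
apply: (@eq_distribution_comp _ _ _ _ X1 X2 (linear_form b \o shift_tuple (mean_tuple X2))) => //.
- exact: (measurableT_comp (measurable_linear_form b) (measurable_shift_tuple _)).
- move=> t; rewrite /dot_rv /linear_form /=; congr dotp; congr row_of_tuple.
  by rewrite (centered_vecE X1) eq_distribution_mean_tuple.
- move=> t; rewrite /dot_rv /linear_form /=; congr dotp; congr row_of_tuple.
  by rewrite (centered_vecE X2).
Qed.

End eq_distribution_centered.

(** * From stop-loss order to tail order, and conditional Jensen *)

Section stop_loss_order.
Context d1 (T1 : measurableType d1) d2 (T2 : measurableType d2) (R : realType).
Context (P1 : probability T1 R) (P2 : probability T2 R).

Lemma eq_distribution_stop_loss (Z1 : {RV P1 >-> R}) (Z2 : {RV P2 >-> R}) c :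
  eq_distribution Z1 Z2 -> stop_loss Z1 c = stop_loss Z2 c.
Proof.
move=> H; congr fine.
apply: (integral_eq_distribution H (f := fun z => (Num.max (z - c) 0)%:E)).
by apply/measurable_EFinP; apply: measurable_maxr => //; exact: measurable_funB.
Qed.

(** The variational bound for [Z] is evaluated at [rv_quant Y a], the minimizer for [Y]. *)
Lemma superquantile_le_stop_loss (Z : {RV P1 >-> R}) (Y : {RV P2 >-> R}) :
  P1.-integrable setT (EFin \o Z) -> P2.-integrable setT (EFin \o Y) ->
  (forall c, stop_loss Z c <= stop_loss Y c)%R ->
  forall a, (0 < a < 1)%R -> (superquantile Z a <= superquantile Y a)%R.
Proof.
move=> iZ iY H a a01; rewrite (superquantileE iY a01).
by apply: le_trans (superquantile_le iZ (rv_quant Y a) a01) _; rewrite lerD2l.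
Qed.

End stop_loss_order.

(* Conditional Jensen for [z |-> max (z - c) 0], tested on the event [Z > c]. *)
Lemma stop_loss_le_cond_exp d (T : measurableType d) (R : realType) (P : probability T R)
    d' (T' : measurableType d') (X : {RV P >-> T'}) (Z Y : {RV P >-> R}) c :
  is_cond_exp P Y X Z -> (stop_loss Z c <= stop_loss Y c)%R.
Proof.
move=> [iY mZ iZ E]; pose A := Z @^-1` `]c, +oo[%classic.
have XA : g_sigma_algebra_preimage X A.
  by have := mZ measurableT _ (measurable_itv `]c, +oo[); rewrite setTI.
have mA : measurable A.
  by have := measurable_funPT Z measurableT _ (measurable_itv `]c, +oo[); rewrite setTI.
have ic : P.-integrable setT (EFin \o cst c) by exact: finite_measure_integrable_cst.
have sub (W : {RV P >-> R}) : P.-integrable setT (EFin \o W) ->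
    \int[P]_(t in A) (W t - c)%:E = \int[P]_(t in A) (W t)%:E - \int[P]_(t in A) (cst c t)%:E.
  move=> iW; rewrite -integralB_EFin//; first exact: integrableS iW.
  exact: integrableS ic.
rewrite -lee_fin /stop_loss /Rintegral !fineK; last 2 first.
- by apply: integrable_fin_num => //; exact: integrable_stop_loss.
- by apply: integrable_fin_num => //; exact: integrable_stop_loss.
have -> : \int[P]_t (Num.max (Z t - c) 0)%:E = \int[P]_(t in A) (Z t - c)%:E.
  rewrite [RHS]integral_mkcond; apply: eq_integral => t _; rewrite patchE.
  case: ifPn; rewrite ?inE ?notin_setE /A /= in_itv/= andbT => H.
    by congr EFin; apply/max_idPl; rewrite subr_ge0 ltW.
  by congr EFin; apply/max_idPr; rewrite subr_le0 leNgt; exact/negP.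
have -> : \int[P]_(t in A) (Z t - c)%:E = \int[P]_(t in A) (Y t - c)%:E by rewrite !sub// E.
rewrite [leLHS]integral_mkcond; apply: le_integral => //.
- rewrite -integrable_mkcond//; apply: (integrableS measurableT) => //.
  exact: (@integrableB _ _ _ P _ measurableT (EFin \o Y) (cst c%:E)).
- exact: integrable_stop_loss.
- move=> t _; rewrite patchE; case: ifPn => _; rewrite lee_fin le_max ?lexx//.
  by rewrite orbT.
Qed.

(** * Membership in the identified set as a stop-loss order *)

Section identified_set_stop_loss.
Context d (T : measurableType d) (R : realType) (P : probability T R) (p : nat).
Variables (X : {RV P >-> p.-tuple R}) (Y : {RV P >-> R}).
Hypothesis iX : forall i, P.-integrable setT (EFin \o component X i).
Hypothesis iY : P.-integrable setT (EFin \o Y).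
Let Y0 : {RV P >-> R} := centered P Y.
Let Zb b : {RV P >-> R} := dot_rv (centered_vec P X) b.

Lemma dot_rv_centeredE b t :
  dot_rv (centered_vec P X) b t = (\sum_i centered P (component X i) t * b 0 i)%R.
Proof. by apply: eq_bigr => i _; rewrite mxE tnth_mktuple. Qed.

Lemma integrable_dot_rv b : P.-integrable setT (EFin \o Zb b).
Proof.
rewrite (_ : EFin \o _ = (fun t => \sum_i (centered P (component X i) t * b 0%R i)%:E)).
  apply: integrable_sum => // i _.
  rewrite (_ : (fun t => _) = (fun t => (b 0%R i)%:E * (EFin \o centered P (component X i)) t)).
    by apply: integrableZl => //; apply: integrable_centered; exact: iX.
  by apply/funext => t /=; rewrite -EFinM mulrC.
by apply/funext => t /=; rewrite dot_rv_centeredE sumEFin.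
Qed.

Lemma integral_dot_rv b : \int[P]_t (Zb b t)%:E = 0.
Proof.
rewrite (eq_integral (fun t => \sum_i (centered P (component X i) t * b 0%R i)%:E)); last first.
  by move=> t _; rewrite sumEFin -dot_rv_centeredE.
have ii i : P.-integrable setT (fun t => (centered P (component X i) t * b 0%R i)%:E).
  rewrite (_ : (fun t => _) = (fun t => (b 0%R i)%:E * (EFin \o centered P (component X i)) t)).
    by apply: integrableZl => //; apply: integrable_centered; exact: iX.
  by apply/funext => t /=; rewrite -EFinM mulrC.
rewrite integral_sum//; apply: big1 => i _.
under eq_integral do rewrite EFinM muleC.
rewrite integralZl//; last by apply: integrable_centered; exact: iX.
by rewrite [X in _ * X](integral_centered (iX i)) mule0.
Qed.

(** Jensen is applied on the witness space; stop-loss transforms depend only on laws, so the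
    inequality returns to the original space. *)
Lemma identified_set_stop_loss b : identified_set X Y b ->
  forall c, (stop_loss (Zb b) c <= stop_loss Y0 c)%R.
Proof.
move=> [d' [T' [P' [X' [Y' [ce HX HY]]]]]] c.
have H := @stop_loss_le_cond_exp _ _ _ _ _ _ (centered_vec P' X' : {RV P' >-> p.-tuple R})
  (dot_rv (centered_vec P' X') b : {RV P' >-> R}) (centered P' Y' : {RV P' >-> R}) c ce.
rewrite (eq_distribution_stop_loss c (eq_distribution_dot_rv HX b)) in H.
by rewrite (eq_distribution_stop_loss c (eq_distribution_centered HY)) in H.
Qed.

Lemma superquantile_identified_set b :
  (forall a, (0 < a < 1)%R -> (superquantile (Zb b) a <= superquantile Y0 a)%R) ->
  identified_set X Y b.
Proof.
move=> H.
have iY0 := integrable_centered iY; have iZ := integrable_dot_rv b.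
have EE : \int[P]_w (Zb b w)%:E = \int[P]_w (Y0 w)%:E.
  by rewrite integral_dot_rv integral_centered.
have [d' [T' [P' [f [Yt [law Ylaw mart]]]]]] := martingale_coupling iZ iY0 EE H.
(* The vector is pulled back along [f]; the mean of [Y] is added back because the coupling concerns
   the centered variables. *)
pose X' : {RV P' >-> p.-tuple R} := (X : {mfun T >-> p.-tuple R}) \o f.
pose m := fine 'E_P[Y].
have mY' : measurable_fun setT (fun w => Yt w + m)%R by exact: measurable_funD.
pose Y' : {RV P' >-> R} := HB.pack (fun w => Yt w + m)%R (isMeasurableFun.Build _ _ _ _ _ mY').
have HX : eq_distribution X' X.
  move=> A mA; rewrite -[LHS]/(P' (f @^-1` (X @^-1` A))) law//.
  by have := measurable_funPT X measurableT A mA; rewrite setTI.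
have HY : eq_distribution Y' Y.
  apply: (@eq_distribution_comp _ _ _ _ _ _ _ _ _ _ _ Yt Y0 (fun y => y + m)%R) => //.
    exact: measurable_funD.
  by move=> t; rewrite /= /Y0 /centered /m subrK.
exists d', T', P', X', Y'; split => //.
have Y'E : centered P' Y' = Yt.
  apply/funext => w; rewrite /centered (eq_distribution_expectation HY) -/m /=.
  by rewrite /Y' /= addrK.
have VE : centered_vec P' X' = centered_vec P X \o f.
  by rewrite !centered_vecE (eq_distribution_mean_tuple HX).
have ZE : dot_rv (centered_vec P' X') b = Zb b \o f by rewrite VE.
split.
- have mE : measurable_fun [set: R] (EFin : R -> \bar R) by exact/measurable_EFinP.
  by rewrite Y'E; exact: (integrable_eq_distribution (eq_distribution_sym Ylaw) mE iY0).
- move=> _ A mA; rewrite setTI /dot_rv.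
  exists (linear_form b @^-1` A); last by rewrite setTI.
  by have := measurable_linear_form b measurableT mA; rewrite setTI.
- rewrite ZE; apply: (integrable_law (measurable_funPT f) law (g := EFin \o Zb b)).
  exact: iZ.
(* An event of the conditioning sigma-algebra is the pullback by [f] of an event of [T], to which
   the martingale clause applies. *)
- move=> A [C mC]; rewrite setTI VE => <-.
  have mB : measurable (centered_vec P X @^-1` C).
    by have := measurable_funPT (centered_vec P X : {mfun T >-> p.-tuple R}) measurableT C mC;
      rewrite setTI.
  rewrite Y'E comp_preimage mart// -(integral_law_set (measurable_funPT f) law (g := EFin \o Zb b))//.
  exact/measurable_EFinP.
Qed.

Theorem identified_setP b :
  identified_set X Y b <-> forall c, (stop_loss (Zb b) c <= stop_loss Y0 c)%R.
Proof.
split=> [|H]; first exact: identified_set_stop_loss.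
apply: superquantile_identified_set; apply: superquantile_le_stop_loss => //.
- exact: integrable_dot_rv.
- exact: integrable_centered.
Qed.

End identified_set_stop_loss.

Section stop_loss_bounds.
Context d (T : measurableType d) (R : realType) (P : probability T R).
Variable Z : {RV P >-> R}.
Hypotheses (iZ : P.-integrable setT (EFin \o Z)) (EZ : \int[P]_t (Z t)%:E = 0).

Lemma stop_loss_ge0 c : (0 <= stop_loss Z c)%R.
Proof. by apply: Rintegral_ge0 => t _; rewrite le_max lexx orbT. Qed.

(** The positive part dominates Z - c, whose mean is -c. *)
Lemma stop_loss_geN c : (- c <= stop_loss Z c)%R.
Proof.
have ic : P.-integrable setT (EFin \o cst c) by exact: finite_measure_integrable_cst.
have -> : (- c)%R = (\int[P]_t (Z t - cst c t))%R.
  rewrite RintegralB// {1}/Rintegral EZ [X in (_ - X)%R]/Rintegral.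
  have := @integral_cst _ _ _ P _ measurableT c%:E.
  rewrite [X in _ = _ * X](@probability_setT _ _ _ P) mule1 => cE.
  by rewrite [X in (_ - fine X)%R]cE /= sub0r.
apply: le_Rintegral => //; last by move=> t _; rewrite le_max lexx.
  exact: (@integrableB _ _ _ P _ measurableT (EFin \o Z) (EFin \o cst c)).
exact: integrable_stop_loss.
Qed.

Lemma superquantile_ge0 a : (0 < a < 1)%R -> (0 <= superquantile Z a)%R.
Proof.
move=> a01; rewrite (superquantileE iZ a01); set c := rv_quant Z a.
have := stop_loss_geN c; have := stop_loss_ge0 c.
by have [c0|c0] := leP 0%R c; nra.
Qed.

(** In [superquantileE], c > 0 makes the first term positive, and for c < 0 [stop_loss_geN] leaves
    at least -a c > 0. The hypothesis on [stop_loss Z 0] settles c = 0. *)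
Lemma superquantile_gt0 a : (0 < stop_loss Z 0)%R -> (0 < a < 1)%R ->
  (0 < superquantile Z a)%R.
Proof.
move=> s0 a01; rewrite (superquantileE iZ a01); set c := rv_quant Z a.
have := stop_loss_geN c; have := stop_loss_ge0 c.
have [c0|c0|c0] := ltgtP 0%R c; last by rewrite -c0 mulr0 add0r.
- by nra.
- by nra.
Qed.

End stop_loss_bounds.

(** * The stop-loss transform as a function of the direction *)

Section stop_loss_of_linear_forms.
Context d (T : measurableType d) (R : realType) (P : probability T R) (p : nat).
Variable (X : {RV P >-> p.-tuple R}).
Hypothesis iX : forall i, P.-integrable setT (EFin \o component X i).
Let Zb b : {RV P >-> R} := dot_rv (centered_vec P X) b.
Let sl b c : R := stop_loss (Zb b) c.

Let iZ b : P.-integrable setT (EFin \o Zb b) := integrable_dot_rv iX b.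

Let ZbE b t : Zb b t = (\sum_i centered P (component X i) t * b 0 i)%R.
Proof. exact: dot_rv_centeredE. Qed.

Let isl b c : P.-integrable setT (EFin \o (fun t => Num.max (Zb b t - c) 0)%R).
Proof. exact: integrable_stop_loss. Qed.

Lemma stop_loss_scale (r : R) b c : (0 <= r)%R -> sl (r *: b) (r * c) = (r * sl b c)%R.
Proof.
move=> r0; rewrite /sl /stop_loss -RintegralZl//.
apply: eq_Rintegral => t _; rewrite /= !dot_rv_centeredE.
rewrite (_ : (\sum_i _)%R = (r * (\sum_i centered P (component X i) t * b 0 i))%R); last first.
  by rewrite mulr_sumr; apply: eq_bigr => i _; rewrite mxE mulrCA.
by rewrite -mulrBr -[X in Num.max _ X](mulr0 r) maxr_pMr.
Qed.

Lemma stop_loss_convex t b b' c : (0 <= t <= 1)%R ->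
  (sl (t *: b + (1 - t) *: b') c <= t * sl b c + (1 - t) * sl b' c)%R.
Proof.
move=> t01; rewrite /sl /stop_loss -!RintegralZl// -RintegralD//; last 2 first.
- exact: (integrableZl measurableT t (isl b c)).
- exact: (integrableZl measurableT (1 - t)%R (isl b' c)).
apply: le_Rintegral => //.
  exact: (integrableD measurableT (integrableZl measurableT t (isl b c))
    (integrableZl measurableT (1 - t)%R (isl b' c))).
move=> w _; rewrite /= (_ : Zb (t *: b + (1 - t) *: b')%R w = t * Zb b w + (1 - t) * Zb b' w)%R.
  set z := Zb b w; set z' := Zb b' w.
  have h1 : (z - c <= Num.max (z - c) 0)%R by rewrite le_max lexx.
  have h2 : (z' - c <= Num.max (z' - c) 0)%R by rewrite le_max lexx.
  have h3 : (0 <= Num.max (z - c) 0)%R by rewrite le_max lexx orbT.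
  have h4 : (0 <= Num.max (z' - c) 0)%R by rewrite le_max lexx orbT.
  move: (Num.max (z - c) 0)%R (Num.max (z' - c) 0)%R h1 h2 h3 h4 => M M' h1 h2 h3 h4.
  by rewrite ge_max; apply/andP; split; nra.
rewrite !ZbE !mulr_sumr -big_split; apply: eq_bigr => i _ /=.
by rewrite !mxE; lra.
Qed.

Let S : R := (\int[P]_t \sum_i `|centered P (component X i) t|)%R.

Let iS : P.-integrable setT (EFin \o (fun t => \sum_i `|centered P (component X i) t|)%R).
Proof.
rewrite (_ : EFin \o _ = (fun t => \sum_i (`|centered P (component X i) t|)%:E)).
  apply: integrable_sum => // i _.
  by apply: (integrable_norm (f := centered P (component X i))); apply: integrable_centered; exact: iX.
by apply/funext => t /=; rewrite sumEFin.
Qed.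

(** The positive part is 1-Lipschitz; the constant is the mean of the sum of the absolute centered
    components, the norm on rows being the sup norm. *)
Lemma stop_loss_lipschitz : exists2 C : R, (0 <= C)%R & forall b b' c, (`|sl b c - sl b' c| <= C * `|b - b'|)%R.
Proof.
exists S; first by apply: Rintegral_ge0 => t _; apply: sumr_ge0.
suff H b b' c : (sl b c <= sl b' c + S * `|b - b'|)%R.
  move=> b b' c; have H1 := H b b' c; have H2 := H b' b c.
  by rewrite -(normrN (b' - b)%R) opprB in H2; rewrite ler_norml; apply/andP; split; lra.
rewrite /sl /stop_loss /S mulrC -RintegralZl// -RintegralD//; last first.
  exact: (integrableZl measurableT `|b - b'|%R iS).
apply: le_Rintegral => //.
  exact: (integrableD measurableT (isl b' c) (integrableZl measurableT `|b - b'|%R iS)).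
move=> t _ /=.
have H : (Zb b t - Zb b' t <= `|b - b'| * \sum_i `|centered P (component X i) t|)%R.
  rewrite !ZbE -sumrB mulr_sumr; apply: ler_sum => i _.
  rewrite -mulrBr; apply: (le_trans (ler_norm _)); rewrite normrM mulrC.
  apply: ler_wpM2r => //; rewrite (_ : b 0 i - b' 0 i = (b - b') 0 i)%R; last by rewrite !mxE.
  by rewrite [leRHS]/Num.Def.normr/= mx_normrE; apply/bigmax_geP; right; exists (0%R, i).
have H0 : (0 <= `|b - b'| * \sum_i `|centered P (component X i) t|)%R.
  by rewrite mulr_ge0// sumr_ge0.
rewrite ge_max; apply/andP; split; last by rewrite addr_ge0// le_max lexx orbT.
have M : (Zb b' t - c <= Num.max (Zb b' t - c) 0)%R by rewrite le_max lexx.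
have -> : (Zb b t - c = (Zb b t - Zb b' t) + (Zb b' t - c))%R by lra.
by rewrite addrC lerD.
Qed.

Lemma continuous_stop_loss c : continuous (fun b : 'rV[R]_p => sl b c).
Proof.
have [C C0 HC] := stop_loss_lipschitz.
move=> b; have Fb := nbhs_filter b; apply/(@cvgrPdist_le _ _ _ _ Fb) => e e0; near=> b'.
(* [C] may vanish, hence the divisor [C + 1]. *)
apply: (le_trans (HC b b' c)); apply: (@le_trans _ _ ((C + 1) * (e / (C + 1))))%R.
  apply: ler_pM => //; first by lra.
  near: b'; apply: cvgr_dist_le => //; by rewrite divr_gt0//; lra.
by rewrite mulrC divfK//; apply/eqP; lra.
Unshelve. all: by end_near. Qed.

End stop_loss_of_linear_forms.

(** * Second moments and non-degeneracy *)

Section square_integrable_vector.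
Context d (T : measurableType d) (R : realType) (P : probability T R) (p : nat).
Variable (X : {RV P >-> p.-tuple R}).
Hypothesis X2 : 'E_P[fun t => dotp (row_of_tuple (X t)) (row_of_tuple (X t))] < +oo.

Lemma dotp_self t : (dotp (row_of_tuple (X t)) (row_of_tuple (X t)) =
  \sum_i component X i t ^+ 2)%R.
Proof. by apply: eq_bigr => i _; rewrite !mxE. Qed.

Lemma integrable_component_sqr i : P.-integrable setT (EFin \o (fun t => component X i t ^+ 2)%R).
Proof.
have iS : P.-integrable setT (EFin \o (fun t => \sum_i component X i t ^+ 2)%R).
  apply/integrableP; split.
    by apply/measurable_EFinP; apply: measurable_sum => j; exact: measurable_funX.
  move: X2; rewrite unlock; congr (_ < _); apply: eq_integral => t _.
  by rewrite dotp_self /= ger0_norm// sumr_ge0// => j _; exact: sqr_ge0.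
apply: (le_integrable measurableT _ _ iS) => //.
  by apply/measurable_EFinP; exact: measurable_funX.
move=> t _ /=; rewrite lee_fin !ger0_norm ?sqr_ge0//; last first.
  by rewrite sumr_ge0// => j _; exact: sqr_ge0.
by rewrite (bigD1 i)//= lerDl sumr_ge0// => j _; exact: sqr_ge0.
Qed.

Lemma integrable_component i : P.-integrable setT (EFin \o component X i).
Proof.
have i1 : P.-integrable setT (EFin \o (fun t => component X i t ^+ 2 + cst 1 t)%R).
  exact: (integrableD measurableT (integrable_component_sqr i)
    (finite_measure_integrable_cst P 1%R measurableT)).
apply: (le_integrable measurableT _ _ i1) => //.
  exact/measurable_EFinP.
move=> t _ /=; rewrite lee_fin [leRHS]ger0_norm ?addr_ge0 ?sqr_ge0//.
by rewrite ler_norml; apply/andP; split; set x := component X i t; rewrite expr2; nra.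
Qed.

Lemma integrable_centered_mul i j : P.-integrable setT
  (EFin \o (fun t => centered P (component X i) t * centered P (component X j) t)%R).
Proof.
set mi := fine 'E_P[component X i]; set mj := fine 'E_P[component X j].
(* The dominating function 2 x^2 + 2 y^2 + 2 mi^2 + 2 mj^2 comes from |u v| <= (u^2 + v^2)/2 and (x
   - mi)^2 <= 2 x^2 + 2 mi^2. *)
have iD := integrableD measurableT
  (integrableZl measurableT 2%R (integrable_component_sqr i))
  (integrableD measurableT (integrableZl measurableT 2%R (integrable_component_sqr j))
    (finite_measure_integrable_cst P (2 * mi ^+ 2 + 2 * mj ^+ 2)%R measurableT)).
apply: (le_integrable measurableT _ _ iD) => //.
  by apply/measurable_EFinP; exact: measurable_funM.
move=> t _ /=; rewrite lee_fin /centered -/mi -/mj.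
set x := component X i t; set y := component X j t.
rewrite [leRHS]ger0_norm; last by rewrite !expr2; nra.
have h1 := sqr_ge0 (x + mi)%R; have h2 := sqr_ge0 (y + mj)%R.
have h3 := sqr_ge0 (x - mi - (y - mj))%R; have h4 := sqr_ge0 (x - mi + (y - mj))%R.
by rewrite ler_norml; move: h1 h2 h3 h4; rewrite !expr2 => *; apply/andP; split; nra.
Qed.

Let Zb b : {RV P >-> R} := dot_rv (centered_vec P X) b.

Let ZbE b t : Zb b t = (\sum_i centered P (component X i) t * b 0 i)%R.
Proof. exact: dot_rv_centeredE. Qed.

(** The covariance of X_i and X'b as an integral, so that X_0'b = 0 almost surely puts b in the
    kernel of the variance matrix. *)
Lemma variance_matrix_mul b i : (variance_matrix P X *m b^T)%R i 0%R =
  (\int[P]_t (centered P (component X i) t * Zb b t))%R.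
Proof.
rewrite mxE; have -> : (\int[P]_t (centered P (component X i) t * Zb b t) =
    \int[P]_t (\sum_j b 0 j * (centered P (component X i) t * centered P (component X j) t)))%R.
  apply: eq_Rintegral => t _; rewrite ZbE mulr_sumr.
  by apply: eq_bigr => j _; lra.
transitivity (\sum_j (b 0 j * \int[P]_t (centered P (component X i) t * centered P (component X j) t)))%R.
  apply: eq_bigr => j _; rewrite !mxE mulrC; congr (_ * _)%R.
  rewrite covariance.unlock unlock /Rintegral; congr fine; apply: eq_integral => t _.
  rewrite /centered unlock.
  exact: erefl.
have ii j := integrableZl measurableT (b 0%R j) (integrable_centered_mul i j).
rewrite /Rintegral (eq_integral (fun t => \sum_j (b 0 j * (centered P (component X i) t * centered P (component X j) t))%:E)); last first.
  by move=> t _; rewrite sumEFin.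
rewrite integral_sum// (eq_bigr (fun j => (b 0 j * \int[P]_t (centered P (component X i) t *
    centered P (component X j) t))%R%:E)); first by rewrite sumEFin.
move=> j _; rewrite -RintegralZl//; last exact: integrable_centered_mul.
by rewrite /Rintegral fineK//; apply: integrable_fin_num => //; exact: ii.
Qed.

(** If the positive part of X_0'b has integral 0, then X_0'b <= 0 almost surely; having mean 0 it
    vanishes almost surely, whence V(X) b = 0 and b = 0. *)
Lemma stop_loss0_gt0 b : variance_matrix P X \in unitmx -> b != 0%R ->
  (0 < stop_loss (Zb b) 0)%R.
Proof.
move=> uV b0; rewrite lt_neqAle stop_loss_ge0 andbT eq_sym.
apply: contraNneq b0 => s0.
have iZ : P.-integrable setT (EFin \o Zb b) := integrable_dot_rv integrable_component b.
have iS := integrable_stop_loss iZ 0%R.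
have le0 : {ae P, forall t, (Zb b t <= cst 0 t)%R}.
  have : \int[P]_t `|(Num.max (Zb b t - 0) 0)%:E| = 0.
    rewrite -[RHS](_ : (stop_loss (Zb b) 0)%:E = 0); last by rewrite s0.
    rewrite /stop_loss /Rintegral fineK; last exact: integrable_fin_num.
    by apply: eq_integral => t _; rewrite gee0_abs// lee_fin le_max lexx orbT.
  move/ae_eq_integral_abs => /(_ measurableT (measurable_int _ iS)) [N [mN N0 sN]].
  exists N; split => // t /= nle; apply: sN => /= /(_ Logic.I) [] H; apply: nle.
  have M : (Zb b t <= Num.max (Zb b t - 0) 0)%R by rewrite subr0 le_max lexx.
  by apply: (le_trans M); rewrite /Zb H.
have Z0 : {ae P, forall t, Zb b t = cst 0%R t}.
  apply: ae_eq_of_le_integral => //.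
    exact: (finite_measure_integrable_cst P 0%R measurableT).
  rewrite (integral_dot_rv integrable_component).
  by rewrite integral0.
have V0 : (variance_matrix P X *m b^T = 0)%R.
  apply/matrixP => i j; rewrite ord1 variance_matrix_mul mxE.
  rewrite /Rintegral (@ae_eq_integral _ _ _ P _ (cst 0))//.
  - by rewrite integral0.
  - by apply/measurable_EFinP; exact: measurable_funM.
  - have [N [mN N0 sN]] := Z0; exists N; split => // t /= nE; apply: sN => /= E.
    by apply: nE => _; rewrite E mulr0.
by rewrite -[b]trmxK -[b^T](mulKmx uV) V0 mulmx0 trmx0.
Qed.

End square_integrable_vector.

Lemma integrable_of_sqr d (T : measurableType d) (R : realType) (P : probability T R)
    (Y : {RV P >-> R}) :
  'E_P[fun t => (Y t ^+ 2)%R] < +oo -> P.-integrable setT (EFin \o Y).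
Proof.
move=> Y2; have i2 : P.-integrable setT (EFin \o (fun t => Y t ^+ 2)%R).
  apply/integrableP; split; first by apply/measurable_EFinP; exact: measurable_funX.
  move: Y2; rewrite unlock; congr (_ < _); apply: eq_integral => t _.
  by rewrite /= ger0_norm// sqr_ge0.
have i1 : P.-integrable setT (EFin \o (fun t => Y t ^+ 2 + cst 1 t)%R).
  exact: (integrableD measurableT i2 (finite_measure_integrable_cst P 1%R measurableT)).
apply: (le_integrable measurableT _ _ i1) => //.
  exact/measurable_EFinP.
move=> t _ /=; rewrite lee_fin [leRHS]ger0_norm ?addr_ge0 ?sqr_ge0//.
by rewrite ler_norml; apply/andP; split; set x := Y t; rewrite expr2; nra.
Qed.

(** * Rays, support function and projection of the identified set *)

Section support.
Context (R : realType) (d : measure_display) (T : measurableType d) (P : probability T R) (p : nat).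
Variables (X : {RV P >-> p.-tuple R}) (Y : {RV P >-> R}).
Hypothesis iX : forall i, P.-integrable setT (EFin \o component X i).
Hypothesis iY : P.-integrable setT (EFin \o Y).
Hypothesis sl0 : forall b, b != 0%R ->
  (0 < stop_loss (dot_rv (centered_vec P X) b : {RV P >-> R}) 0)%R.
Let Y0 : {RV P >-> R} := centered P Y.
Let Zb b : {RV P >-> R} := dot_rv (centered_vec P X) b.
Let B := identified_set X Y.

Let iY0 : P.-integrable setT (EFin \o Y0) := integrable_centered iY.
Let EY0 : \int[P]_t (Y0 t)%:E = 0 := integral_centered iY.
Let iZ b : P.-integrable setT (EFin \o Zb b) := integrable_dot_rv iX b.
Let EZ b : \int[P]_t (Zb b t)%:E = 0 := integral_dot_rv iX b.

Let BP b : B b <-> forall c, (stop_loss (Zb b) c <= stop_loss Y0 c)%R := identified_setP iX iY b.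

(** The stop-loss transform of r q at c is r times that of q at c/r, so tail integrals scale by r
    and the ray is cut by inequalities linear in r. *)
Lemma identified_set_scaleP (q : 'rV[R]_p) r : (0 <= r)%R ->
  B (r *: q) <-> forall a, (0 < a < 1)%R -> (r * superquantile (Zb q) a <= superquantile Y0 a)%R.
Proof.
move=> r0; split.
  move=> /BP H a a01.
  move: r0; rewrite le_eqVlt => /predU1P[<-|r0].
    by rewrite mul0r superquantile_ge0.
  rewrite (superquantileE iY0 a01); set c := rv_quant Y0 a.
  apply: (@le_trans _ _ ((1 - a) * c + stop_loss (Zb (r *: q)) c))%R; last by rewrite lerD2l.
  have := superquantile_le (iZ q) (c / r)%R a01.
  rewrite -(ler_pM2l r0) mulrDr -(stop_loss_scale iX q (c / r)%R (ltW r0)).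
  rewrite (_ : r * ((1 - a) * (c / r)) = (1 - a) * c)%R; last by field; rewrite gt_eqF.
  by rewrite (_ : r * (c / r) = c)%R; last by field; rewrite gt_eqF.
move=> H; apply: superquantile_identified_set => // a a01.
apply: le_trans (H a a01); rewrite (superquantileE (iZ q) a01); set c := rv_quant _ a.
apply: le_trans (superquantile_le (iZ (r *: q)%R) (r * c)%R a01) _.
by rewrite (stop_loss_scale iX) //; lra.
Qed.

Let S q := inf_tail_ratio (cdf Y0) (cdf (Zb q)).

(** Positive denominators turn each linear inequality into r <= ratio, and S is the infimum of the
    ratios. It is finite and nonnegative, so the threshold itself is admissible. *)
Lemma inf_tail_ratioP (q : 'rV[R]_p) : q != 0%R ->
  exists2 s, (0 <= s)%R & S q = s%:E /\ forall r, (0 <= r)%R -> B (r *: q) <-> (r <= s)%R.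
Proof.
move=> q0.
have sq0 a : (0 < a < 1)%R -> (0 < superquantile (Zb q) a)%R.
  by move=> a01; apply: superquantile_gt0 => //; exact: sl0.
have tE a : (0 < a < 1)%R ->
    tail_ratio a (cdf Y0) (cdf (Zb q)) = (superquantile Y0 a / superquantile (Zb q) a)%:E.
  move=> a01; rewrite /tail_ratio !tail_integral_quantile//.
  by rewrite inver gt_eqF ?sq0// -EFinM.
have S0 : 0 <= S q.
  apply: le_ereal_inf_tmp => _ [a /= /[!in_itv]/= a01 <-].
  by rewrite tE// lee_fin divr_ge0 ?superquantile_ge0// ltW// sq0.
(* One finite ratio suffices for a finite infimum; the level 1/2 is arbitrary. *)
have h01 : (0 < (2^-1 : R) < 1)%R by lra.
have Sfin : S q \is a fin_num.
  rewrite ge0_fin_numE//; apply: (@le_lt_trans _ _ (tail_ratio 2^-1 (cdf Y0) (cdf (Zb q)))).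
    by apply: ereal_inf_lbound; exists 2^-1%R => //=; rewrite in_itv.
  by rewrite tE// ltry.
exists (fine (S q)); first by rewrite fine_ge0.
split; first by rewrite fineK.
move=> r r0; rewrite identified_set_scaleP//; split => H.
  rewrite -lee_fin fineK//; apply: le_ereal_inf_tmp => _ [a /= /[!in_itv]/= a01 <-].
  by rewrite tE// lee_fin ler_pdivlMr ?sq0// H.
move=> a a01; rewrite -ler_pdivlMr ?sq0// -lee_fin -tE//.
apply: (@le_trans _ _ (S q)); first by rewrite -(fineK Sfin) lee_fin.
by apply: ereal_inf_lbound; exists a => //=; rewrite in_itv.
Qed.

Let B0 : B 0%R.
Proof.
rewrite -(scale0r (0 : 'rV[R]_p)); apply/identified_set_scaleP => // a a01.
by rewrite mul0r superquantile_ge0.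
Qed.

(** The hypothesis s s = 1 covers both signs s = 1 and s = -1 at once. *)
Lemma support_function_coord (k : 'I_p) (s : R) : (s * s = 1)%R ->
  support_function B (s *: delta_mx 0 k)%R =
  (ereal_inf [set (S q)^-1 | q in [set q : 'rV[R]_p | q 0%R k = s]])^-1.
Proof.
move=> ss.
have dE b : dotp (s *: delta_mx 0 k)%R b = (s * b 0 k)%R.
  rewrite /dotp (bigD1 k)//= big1 ?addr0; first by rewrite !mxE !eqxx mulr1.
  by move=> i ik; rewrite !mxE (negbTE ik) andbF mulr0 mul0r.
have qn0 (q : 'rV[R]_p) : q 0%R k = s -> q != 0%R.
  move=> qs; apply/eqP => q0; move: ss; rewrite -qs q0 mxE mul0r => /esym/eqP.
  by rewrite oner_eq0.
set sg := support_function _ _; set J := ereal_inf _.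
have sg0 : 0 <= sg.
  apply: ereal_sup_ubound; exists 0%R; first exact: B0.
  by rewrite dE mxE mulr0.
have S0 (q : 'rV[R]_p) : q 0%R k = s -> 0 <= S q.
  by move=> /qn0/inf_tail_ratioP[t t0 [-> _]]; rewrite lee_fin.
have J0 : 0 <= J.
  by apply: le_ereal_inf_tmp => _ [q /= qk <-]; rewrite inve_ge0 S0.
apply/eqP; rewrite eq_le; apply/andP; split.
  apply: ge_ereal_sup => _ [b Bb <-]; rewrite dE.
  (* The right-hand side is nonnegative, so only a positive coordinate needs to be rescaled to
     [s]. *)
  have [b0|b0] := leP (s * b 0 k)%R 0%R.
    by apply: (@le_trans _ _ 0); rewrite ?lee_fin// inve_ge0.
  set t := (s * b 0 k)%R in b0 *.
  pose q := (t^-1 *: b)%R.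
  have qk : q 0%R k = s.
    rewrite mxE; apply: (mulfI (lt0r_neq0 b0)); rewrite mulrA divff ?gt_eqF// mul1r.
    by rewrite /t mulrC mulrA ss mul1r.
  have [r r0 [Sr /(_ t (ltW b0)) H]] := inf_tail_ratioP (qn0 _ qk).
  have tr : (t <= r)%R by apply/H; rewrite /q scalerA divff ?gt_eqF// scale1r.
  apply: (@le_trans _ _ (S q)); first by rewrite Sr lee_fin.
  rewrite inve_pge ?inE ?S0//.
  by apply: ereal_inf_lbound; exists q.
rewrite inve_ple ?inE//; apply: le_ereal_inf_tmp => _ [q /= qk <-].
(* With r = S q, the vector r q is admissible and has the value S q in direction s e_k. If S q = 0
   its inverse is [+oo], and the comparison still holds. *)
have [r r0 [Sr /(_ r r0) H]] := inf_tail_ratioP (qn0 _ qk).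
rewrite lee_pV2 ?inE ?S0//; apply: ereal_sup_ubound; exists (r *: q)%R; first exact/H.
by rewrite dE mxE qk Sr mulrCA ss mulr1.
Qed.

Let B_convex b b' (t : R) : (0 <= t <= 1)%R -> B b -> B b' -> B (t *: b + (1 - t) *: b')%R.
Proof.
move=> t01 /BP H /BP H'; apply/BP => c.
apply: le_trans (stop_loss_convex iX b b' c t01) _.
have := H c; have := H' c; rewrite /Zb => h' h.
by move: t01 => /andP[t0 t1]; nra.
Qed.

Let B_closed : closed B.
Proof.
rewrite (_ : B = \bigcap_c [set b | stop_loss (Zb b) c <= stop_loss Y0 c]%R); last first.
  by apply/seteqP; split => b; [move=> /BP H c _; exact: H|move=> H; apply/BP => c; exact: H].
apply: closed_bigI => c _.
have := @continuous_stop_loss _ _ _ _ _ _ iX c; rewrite continuous_closedP => /(_ _ (@closed_le R (stop_loss Y0 c))).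
exact.
Qed.

(** With m the minimum of E(X_0'u)^+ on the unit sphere, homogeneity gives |b| m <= E(X_0'b)^+ <=
    E(Y_0)^+ on the set. The index [k] supplies a nonzero row, hence a nonempty sphere. *)
Let B_bounded (k : 'I_p) : bounded_set B.
Proof.
pose Sph : set 'rV[R]_p := [set u | (`|u| = 1)%R].
have e0 : (delta_mx 0%R k : 'rV[R]_p) != 0%R.
  apply/eqP => /matrixP/(_ 0%R k)/eqP; rewrite !mxE !eqxx oner_eq0//.
have Sph0 : Sph !=set0.
  exists (`|delta_mx 0 k : 'rV[R]_p|^-1 *: delta_mx 0 k)%R.
  by rewrite /Sph /= normrZ ger0_norm ?invr_ge0// mulVf// normr_eq0.
have cSph : compact Sph.
  apply: bounded_closed_compact.
    by exists 1%R; split => // x x1 u /= ->; exact: ltW.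
  have := @norm_continuous R 'rV[R]_p; rewrite continuous_closedP => /(_ _ (closed_eq (y := 1%R))).
  exact.
have cN : continuous (fun u : 'rV[R]_p => - stop_loss (Zb u) 0)%R.
  move=> u; have H := @continuous_stop_loss _ _ _ _ _ _ iX 0%R u; have Fu := nbhs_filter u.
  exact: (@cvgN _ _ _ _ Fu _ _ H).
have [u uS um] := EVT_max_rV Sph0 cSph (continuous_subspaceT cN).
have u0 : u != 0%R by apply/eqP => u0; move: uS; rewrite inE /Sph /= u0 normr0 => /esym/eqP; rewrite oner_eq0.
set m := stop_loss (Zb u) 0%R in um.
have m0 : (0 < m)%R by exact: sl0.
exists (stop_loss Y0 0 / m)%R; split; first exact: num_real.
move=> x xm b /= /BP Bb.
apply: le_trans (ltW xm).
have [->|b0] := eqVneq b 0%R; first by rewrite normr0 divr_ge0 ?stop_loss_ge0// ltW.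
have nb0 : (0 < `|b|)%R by rewrite normr_gt0.
rewrite ler_pdivlMr//; apply: le_trans (Bb 0%R).
have vS : (`|b|^-1 *: b)%R \in Sph.
  by rewrite inE /Sph /= normrZ ger0_norm ?invr_ge0// mulVf// gt_eqF.
have := um _ vS; rewrite lerN2 => mv.
rewrite -(ler_pM2l nb0) in mv; apply: le_trans mv _.
have := stop_loss_scale iX (`|b|^-1 *: b)%R 0%R (ltW nb0).
by rewrite mulr0 scalerA divff ?gt_eqF// scale1r /Zb => ->.
Qed.

(** Compactness makes both extrema of b_k attained, hence the endpoints finite and included;
    convexity fills the interval. *)
Lemma identified_set_component_itv (k : 'I_p) :
  EFin @` identified_set_component X Y k =
  `[- support_function B (- delta_mx 0%R k)%R, support_function B (delta_mx 0%R k)]%classic.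
Proof.
have dE b : dotp (delta_mx 0%R k) b = b 0%R k.
  rewrite /dotp (bigD1 k)//= big1 ?addr0; first by rewrite !mxE !eqxx mul1r.
  by move=> i ik; rewrite !mxE (negbTE ik) andbF mul0r.
have dNE b : dotp (- delta_mx 0 k)%R b = (- b 0%R k)%R.
  by rewrite -dE /dotp -sumrN; apply: eq_bigr => i _; rewrite mxE mulNr.
have cB : compact B by apply: bounded_closed_compact; [exact: B_bounded|exact: B_closed].
have Bn0 : B !=set0 by exists 0%R; exact: B0.
have cc : continuous (fun b : 'rV[R]_p => b 0%R k) by exact: coord_continuous.
have [bM BM hM] := EVT_max_rV Bn0 cB (continuous_subspaceT cc).
have cN : continuous (fun b : 'rV[R]_p => - b 0%R k)%R by move=> b; apply: continuousN; exact: cc.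
have [bm Bm hm] := EVT_max_rV Bn0 cB (continuous_subspaceT cN).
rewrite !inE in BM Bm.
have sM : support_function B (delta_mx 0%R k) = (bM 0%R k)%:E.
  apply/eqP; rewrite eq_le; apply/andP; split.
    by apply: ge_ereal_sup => _ [b Bb <-]; rewrite dE lee_fin; apply: hM; rewrite inE.
  by apply: ereal_sup_ubound; exists bM => //; rewrite dE.
have sm : support_function B (- delta_mx 0 k)%R = (- bm 0%R k)%:E.
  apply/eqP; rewrite eq_le; apply/andP; split.
    by apply: ge_ereal_sup => _ [b Bb <-]; rewrite dNE lee_fin; apply: hm; rewrite inE.
  by apply: ereal_sup_ubound; exists bm => //; rewrite dNE.
rewrite sM sm EFinN oppeK; apply/seteqP; split => x /=.
  move=> [_ [b Bb <-] <-]; rewrite dE in_itv/= !lee_fin.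
  have := hM b; have := hm b; rewrite !inE lerN2 => h1 h2.
  by rewrite h1 ?h2.
case: x => [r| |].
- rewrite in_itv/= !lee_fin => /andP[mr rM]; exists r => //.
  have [mM|mM] := eqVneq (bm 0%R k) (bM 0%R k).
    by exists bM => //; rewrite dE; apply/eqP; rewrite eq_le -{1}mM mr rM.
  have lt : (bm 0 k < bM 0 k)%R by rewrite lt_neqAle mM (le_trans mr rM).
  (* Solves t bM_k + (1 - t) bm_k = r. *)
  pose t := ((r - bm 0 k) / (bM 0 k - bm 0 k))%R.
  exists (t *: bM + (1 - t) *: bm)%R.
    apply: B_convex => //; rewrite /t divr_ge0 ?ler_pdivrMr ?mul1r ?subr_ge0 ?(ltW lt)//; lra.
  rewrite dE !mxE /t; field; rewrite subr_eq0 gt_eqF//.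
(* The interval lives in the extended reals; its finite endpoints exclude both infinities. *)
- by rewrite in_itv/= => /andP[_]; rewrite leye_eq.
- by rewrite in_itv.
Qed.

End support.

Unset Implicit Arguments.

Theorem corollary1 (R : realType) (d : measure_display) (T : measurableType d)
    (P : probability T R) (p : nat)
    (X : {RV P >-> p.-tuple R}) (Y : {RV P >-> R})
    (hY2 : 'E_P[fun t => (Y t ^+ 2)%R] < +oo)
    (hX2 : 'E_P[fun t => dotp (row_of_tuple (X t)) (row_of_tuple (X t))] < +oo)
    (hVY : 0 < 'V_P[Y])
    (hVX : variance_matrix P X \in unitmx)
    (hlin : exists (alpha0 : R) (beta0 : 'rV[R]_p),
        is_cond_exp P Y X (fun t => (alpha0 + dot_rv X beta0 t)%R))
    (k : 'I_p) :
  let sigma := support_function (identified_set X Y) in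
  let FY0 := cdf (centered P Y : {RV P >-> R}) in
  let FX0 q := cdf (dot_rv (centered_vec P X) q : {RV P >-> R}) in
  let e_k := delta_mx 0%R k : 'rV[R]_p in
  [/\ EFin @` identified_set_component X Y k =
        `[- sigma (- e_k)%R, sigma e_k]%classic,
      sigma e_k =
        (ereal_inf [set (inf_tail_ratio FY0 (FX0 q))^-1
                   | q in [set q : 'rV[R]_p | q 0%R k = 1%R]])^-1 &
      sigma (- e_k)%R =
        (ereal_inf [set (inf_tail_ratio FY0 (FX0 q))^-1
                   | q in [set q : 'rV[R]_p | q 0%R k = (- 1)%R]])^-1].
Proof.
move=> sigma FY0 FX0 e_k.
have iX := integrable_component hX2.
have iY := integrable_of_sqr hY2.
have sl0 b : b != 0%R -> (0 < stop_loss (dot_rv (centered_vec P X) b : {RV P >-> R}) 0)%R.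
  exact: (stop_loss0_gt0 hX2 hVX).
split.
- exact: (identified_set_component_itv iX iY sl0).
- rewrite -(support_function_coord iX iY sl0 k (mulr1 1%R)).
  by rewrite scale1r.
- have NN : (- 1 * - 1 = 1 :> R)%R by rewrite mulrNN mulr1.
  rewrite -(support_function_coord iX iY sl0 k NN).
  by rewrite scaleN1r.
Qed.
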